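(* Let $\alpha>1$, $\eta\in(1,\alpha]$ and $\beta>\alpha^d$. Then $rbmo^{1}_{\mathscr Q}(\mu)=rbmo^{2}_{\mathscr Q}(\mu)$ with equivalent norms; that is, a function $f\in L_{loc}(\mu)$ belongs to $rbmo^{1}_{\mathscr Q}(\mu)$ if and only if it belongs to $rbmo^{2}_{\mathscr Q}(\mu)$, and there is a constant $C\ge1$, independent of $f$, such that $C^{-1}\|f\|_{*1}\le\|f\|_{*2}\le C\|f\|_{*1}$ for all such $f$.
   Context: Let $d\ge 1$ be an integer, $0<n\le d$, and let $\mu$ be a positive Radon measure on $\mathbb R^{d}$ satisfying the growth condition $\mu(Q(x,l))\le C_{0}l^{n}$ for all $x\in\mathbb R^{d}$, $l>0$, with a fixed constant $C_0>0$, where $Q(x,l)$ is the cube centered at $x$ with side length $l$. The measure $\mu$ is not assumed to be doubling. A cube is a closed cube in $\mathbb R^d$ with sides parallel to the coordinate axes; $l(Q)$ is the side length of $Q$ and, for $\lambda>0$, $\lambda Q$ is the cube concentric with $Q$ of side length $\lambda l(Q)$. $L_{loc}(\mu)$ is the space of real-valued locally $\mu$-integrable functions, and $m_Qf=\frac1{\mu(Q)}\int_Q f\,d\mu$. Doubling cubes: with $\alpha>1$ and $\beta>\alpha^d$ fixed, a cube $Q$ is $(\alpha,\beta)$-doubling if $\mu(\alpha Q)\le\beta\mu(Q)$. For a cube $Q$, $\widetilde Q$ is the smallest $(\alpha,\beta)$-doubling cube of the form $\alpha^mQ$ with $m\in\{0,1,2,\dots\}$, and $Q'$ is the biggest $(\alpha,\beta)$-doubling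 cube of the form $\alpha^{-N}Q$ with $N\in\{1,2,\dots\}$. (The assumption $\beta>\alpha^d$ is made to guarantee existence of these cubes; for a given side length, $Q'$ exists for $\mu$-almost every center.) Put $\mathscr Q=\{Q: l(Q)\le 1\}$ and $\mathscr Q_{ex}=\{Q: l(Q')\le 1\}$, where $Q\in\mathscr Q_{ex}$ means that $Q'$ exists and $l(Q')\le1$. For cubes $Q\subset R$, $K_{Q,R}=1+\sum_{k=1}^{N_{Q,R}}\frac{\mu(2^kQ)}{l(2^kQ)^n}$, where $N_{Q,R}$ is the first integer $k\ge 0$ with $l(2^kQ)\ge l(R)$. Conditions below involving means or quotients with a measure in the denominator are imposed only for cubes for which these are defined (positive denominators). $rbmo^1_{\mathscr Q}(\mu)$: the set of $f\in L_{loc}(\mu)$ for which there is a constant $C_3\ge0$ such that (a) for every cube $Q\in\mathscr Q$, $\frac1{\mu(\eta Q)}\int_Q|f-m_{\widetilde Q}f|\,d\mu\le C_3$; (b) for any two $(\alpha,\beta)$-doubling cubes $Q\subset R$ with $Q\in\mathscr Q$ and $R\in\mathscr Q_{ex}$, $|m_Qf-m_Rf|\le C_3K_{Q,R}$; (c) for every cube $Q\in\mathscr Q_{ex}\setminus\mathscr Q$, $\frac1{\mu(\eta Q)}\int_Q|f|\,d\mu\le C_3$. The norm $\|f\|_{*1}$ is the infimum of such $C_3$. $rbmo^2_{\mathscr Q}(\mu)$: the set of $f\in L_{loc}(\mu)$ for which there are a constant $C_4\ge0$ and a collection of real numbers $\{f_Q\}_Q$ (one for each cube $Q$) such that (a)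 $\sup_{Q\in\mathscr Q}\frac1{\mu(\eta Q)}\int_Q|f-f_Q|\,d\mu\le C_4$; (b) for any two cubes $Q\subset R$ with $Q\in\mathscr Q$ and $R\in\mathscr Q_{ex}$, $|f_Q-f_R|\le C_4K_{Q,R}$; (c) for every cube $R\in\mathscr Q_{ex}\setminus\mathscr Q$, $|f_R|\le C_4$. The norm $\|f\|_{*2}$ is the infimum of $C_4$ over all such constants and collections. *)

(* Defs.v *)
From HB Require Import structures.
From mathcomp Require Import all_boot all_order all_algebra.
From mathcomp Require Import all_classical all_reals all_analysis.

Set Implicit Arguments.
Unset Strict Implicit.
Unset Printing Implicit Defensive.
Import Order.TTheory GRing.Theory Num.Theory numFieldNormedType.Exports.
Local Open Scope classical_set_scope.
Local Open Scope ring_scope.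

(* R^d carrying its Borel sigma-algebra. *)
Notation euclidean R d := (g_sigma_algebraType (@open 'rV[R]_d)).

Section measures.
Context {R : realType} {d : nat}.
Variable mu : {measure set (euclidean R d) -> \bar R}.

Definition radon : Prop :=
  [/\ forall K : set 'rV[R]_d, compact K -> (mu K < +oo)%E,
      forall A : set (euclidean R d), measurable A ->
        mu A = ereal_inf [set mu U | U in
                 [set U : set 'rV[R]_d | open U /\ A `<=` U]]
    & forall U : set 'rV[R]_d, open U ->
        mu U = ereal_sup [set mu K | K in
                 [set K : set 'rV[R]_d | compact K /\ K `<=` U]]].

Definition Lloc : set (euclidean R d -> R) :=
  [set f | measurable_fun setT f /\
     forall K : set 'rV[R]_d, compact K -> mu.-integrable K (EFin \o f)].

End measures.

Record cube (R : realType) (d : nat) :=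
  Cube { center : 'rV[R]_d ; side : {posnum R} }.

Section cubes.
Context {R : realType} {d : nat}.
Implicit Types Q S : cube R d.

Definition cset Q : set (euclidean R d) :=
  [set y : 'rV[R]_d | forall i : 'I_d,
     `|y ord0 i - center Q ord0 i| <= (side Q)%:num / 2].

Definition dilate (lambda : {posnum R}) Q : cube R d :=
  Cube (center Q) (lambda%:num * (side Q)%:num)%:pos.

Lemma dyadic_steps_ex Q S :
  exists k : nat, (side S)%:num <= (side (dilate (2 ^+ k)%:pos Q))%:num.
Proof.
have [k hk] : exists k : nat, (side S)%:num / (side Q)%:num <= k%:R.
  exists (Num.truncn ((side S)%:num / (side Q)%:num)).+1.
  by apply/ltW/truncnS_gt.
exists k => /=; rewrite -ler_pdivrMr//; apply: (le_trans hk).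
by rewrite -natrX ler_nat ltnW// ltn_expl.
Qed.

(* N_{Q,S} *)
Definition dyadic_steps Q S : nat := ex_minn (dyadic_steps_ex Q S).

End cubes.

Section rbmo.
Context {R : realType} {d : nat}.
Variable mu : {measure set (euclidean R d) -> \bar R}.
Variables (n : R) (alpha eta : {posnum R}) (beta : R).
Implicit Types (Q S : cube R d) (f : euclidean R d -> R).

Definition growth (C0 : R) : Prop :=
  forall Q, (mu (cset Q) <= (C0 * (side Q)%:num `^ n)%:E)%E.

Definition msr Q : R := fine (mu (cset Q)).

(* m_Q f *)
Definition mean Q f : R := (msr Q)^-1 * \int[mu]_(y in cset Q) f y.

Definition doubling Q : Prop :=
  (mu (cset (dilate alpha Q)) <= beta%:E * mu (cset Q))%E.

(* [is_up Q S] : S is the cube written Q with a tilde. *)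
Definition is_up Q S : Prop :=
  exists m : nat, [/\ S = dilate (alpha%:num ^+ m)%:pos Q, doubling S &
    forall k : nat, (k < m)%N -> ~ doubling (dilate (alpha%:num ^+ k)%:pos Q)].

(* [is_down Q S] : S is the cube written Q'.  It may fail to exist. *)
Definition is_down Q S : Prop :=
  exists N : nat,
    [/\ (0 < N)%N, S = dilate (alpha%:num ^- N)%:pos Q, doubling S &
    forall k : nat, (0 < k < N)%N ->
      ~ doubling (dilate (alpha%:num ^- k)%:pos Q)].

Definition cubesQ : set (cube R d) := [set Q | (side Q)%:num <= 1].

Definition cubesQex : set (cube R d) :=
  [set Q | exists2 S, is_down Q S & (side S)%:num <= 1].

(* K_{Q,S}, for cubes Q contained in S *)
Definition Kcoef Q S : R :=
  1 + \sum_(1 <= k < (dyadic_steps Q S).+1)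
        msr (dilate (2 ^+ k)%:pos Q)
          / (side (dilate (2 ^+ k)%:pos Q))%:num `^ n.

(* C is an admissible C_3 for f.  The conditions 0 < msr _ discard the cubes
   for which a mean or a quotient below is undefined. *)
Definition rbmo1_bound f (C : R) : Prop :=
  [/\ 0 <= C,
      forall Q S, cubesQ Q -> is_up Q S ->
        0 < msr (dilate eta Q) -> 0 < msr S ->
        (msr (dilate eta Q))^-1
          * \int[mu]_(y in cset Q) `|f y - mean S f| <= C,
      forall Q S, doubling Q -> doubling S -> cset Q `<=` cset S ->
        cubesQ Q -> cubesQex S -> 0 < msr Q -> 0 < msr S ->
        `|mean Q f - mean S f| <= C * Kcoef Q S
    & forall Q, (cubesQex `\` cubesQ) Q -> 0 < msr (dilate eta Q) ->
        (msr (dilate eta Q))^-1 * \int[mu]_(y in cset Q) `|f y| <= C].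

(* C is an admissible C_4 for f, with the collection fQ. *)
Definition rbmo2_bound f (fQ : cube R d -> R) (C : R) : Prop :=
  [/\ 0 <= C,
      forall Q, cubesQ Q -> 0 < msr (dilate eta Q) ->
        (msr (dilate eta Q))^-1
          * \int[mu]_(y in cset Q) `|f y - fQ Q| <= C,
      forall Q S, cset Q `<=` cset S -> cubesQ Q -> cubesQex S ->
        `|fQ Q - fQ S| <= C * Kcoef Q S
    & forall S, (cubesQex `\` cubesQ) S -> `|fQ S| <= C].

Definition rbmo1 : set (euclidean R d -> R) :=
  [set f | Lloc mu f /\ exists C, rbmo1_bound f C].

Definition rbmo2 : set (euclidean R d -> R) :=
  [set f | Lloc mu f /\ exists C fQ, rbmo2_bound f fQ C].

Definition rbmo1_norm f : R := inf [set C | rbmo1_bound f C].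

Definition rbmo2_norm f : R := inf [set C | exists fQ, rbmo2_bound f fQ C].

End rbmo.

(* Main.v *)
Require Import Defs.
From HB Require Import structures.
From mathcomp Require Import all_boot all_order all_algebra.
From mathcomp Require Import all_classical all_reals all_analysis.
From mathcomp Require Import measurable_realfun ring lra zify.
Import Order.TTheory GRing.Theory Num.Theory numFieldNormedType.Exports.
Local Open Scope classical_set_scope.
Local Open Scope ring_scope.

(** Both implications are proved with constants that depend only on the data,
    which gives the equality of the two spaces and the equivalence of the norms.
    Write m(x,r) for the measure of the cube of centre x and side r.

    The obstacle is that conditions involving Q_ex say nothing about a cube
    below which there is no smaller doubling cube.  Such cubes are avoided by
    moving their centre slightly: every cube lies in a cube of prescribed larger
    side below which there is a doubling cube [enclosing_cube_with_down].
    Indeed, if this failed, the measure of small cubes would decay faster than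
    the number of them needed to cover a neighbourhood of the centre grows
    (alpha^d < beta), so that the neighbourhood would be null and the small
    cubes with the given centre trivially doubling.  In particular every cube of
    side less than alpha lies in a cube of side alpha that belongs to Q_ex but
    not to Q, where condition (c) applies.

    This first gives the bound of the integral of |f| over R by a constant times
    the measure of eta R for all cubes R of side greater than 1, in Q_ex or not:
    it holds for unit cubes, up to a harmless change of eta, and a large cube is
    covered by a grid of unit cubes whose dilates overlap boundedly
    [large_cube_osc_le].

    The coefficients K are controlled by decay.  If alpha^j Q is the first
    doubling dilate of Q, and x and l are the centre and the side of Q, then
    m(x,r)/r^n is at most a constant times (r/b)^e for r >= l, with
    b = alpha^j l and alpha^(n+e) = beta [decay_le].  The sum defining K is then dominated by a geometric series
    [Kcoef_bounded], or by such series and another coefficient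
    [Kcoef_compare].

    From the numbers f_Q to the means: on a doubling cube in Q the mean differs
    from the number by a bounded amount, on larger cubes the mean is bounded by
    the above, and numbers of comparable cubes are compared through a third,
    enclosing cube of Q_ex [rbmo1_of_rbmo2].

    From the means to the numbers: let S be the first dilate of Q that is
    doubling and of positive measure.  The number is the mean over S when S is
    in Q, and 0 otherwise.  For Q inside R, the cubes S obtained from Q and
    from R are both contained in one doubling cube T, and K for the pair (S,T)
    is at most a constant times K for (Q,R) [hat_value_chain].  When the
    cubes are too large for such a T in Q_ex, each S is compared with its own
    cube T of side at least alpha, where the mean is bounded
    [rbmo2_of_rbmo1]. *)

Set Implicit Arguments.
Unset Strict Implicit.
Unset Printing Implicit Defensive.

Local Notation ctr := Defs.center.
Local Notation len Q := (side Q)%:num.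

(** * Sums and integrals *)

Section sums.
Context {R : realType}.

(** Successive terms have ratio 2^e and the last one kept is at most 1, so that
    a geometric series bounds the sum whatever its starting point a, its length
    N and its scale b. *)
Lemma geometric_sum_bounded (e : R) : 0 < e ->
  exists2 G : R, 0 <= G & forall (a b : R) N, 0 < a -> 0 < b ->
    \sum_(1 <= k < N.+1)
      (if 2 ^+ k * a <= b then (2 ^+ k * a / b) `^ e else 0) <= G.
Proof.
move=> e0.
have q1 : 1 < (2 : R) `^ e.
  rewrite -[ltLHS](_ : (1 : R) `^ e = 1); last by rewrite powR1.
  by apply: gt0_ltr_powR; rewrite ?nnegrE//; lra.
set q := (2 : R) `^ e in q1 *.
have q0 : 0 < q by lra.
have G0 : 0 <= q / (q - 1) by apply: divr_ge0; lra.
exists (q / (q - 1)) => // a b N a0 b0.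
set u := fun k => (2 ^+ k * a / b) `^ e.
have u0 k : 0 <= u k by exact: powR_ge0.
have uS k : u k.+1 = q * u k.
  rewrite /u exprS -!mulrA powRM//; first by rewrite mulr_ge0// ltW// divr_gt0.
(* the first bound, in terms of the last term, makes the induction work *)
suff [_ //] : \sum_(1 <= k < N.+1) (if 2 ^+ k * a <= b then u k else 0)
    <= q / (q - 1) * u N
  /\ \sum_(1 <= k < N.+1) (if 2 ^+ k * a <= b then u k else 0) <= q / (q - 1).
elim: N => [|N [IH1 IH2]]; first by rewrite big_geq// mulr_ge0.
rewrite big_nat_recr//=; case: ifPn => h; last first.
  rewrite addr0; split => //; apply: (le_trans IH1).
  rewrite ler_wpM2l// uS ler_peMl//; exact: ltW.
have h1 : q / (q - 1) * u N + u N.+1 = q / (q - 1) * u N.+1.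
  rewrite uS; field; lra.
have h2 : u N.+1 <= 1.
  rewrite /u -[leRHS](_ : (1 : R) `^ e = 1); last by rewrite powR1.
  apply: ge0_ler_powR; rewrite ?nnegrE//; first exact: ltW.
    by rewrite divr_ge0// ?mulr_ge0 ?exprn_ge0// ltW.
  by rewrite ler_pdivrMr// mul1r.
have h3 : q / (q - 1) * u N.+1 <= q / (q - 1) by rewrite ler_piMr.
by split; lra.
Qed.

Lemma shifted_sum_le (F : nat -> R) (i0 N N' : nat) : (forall k, 0 <= F k) ->
  \sum_(1 <= k < N.+1) (if (k + i0 <= N')%N then F (k + i0)%N else 0)
    <= \sum_(1 <= k < N'.+1) F k.
Proof.
move=> F0.
have mono a b : (a <= b)%N ->
    \sum_(1 <= k < a.+1) F k <= \sum_(1 <= k < b.+1) F k.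
  move=> ab; rewrite (@big_cat_nat _ _ _ a.+1 1 b.+1)//= lerDl.
  by apply: sumr_ge0.
apply: (@le_trans _ _ (\sum_(1 <= k < (minn (N + i0) N').+1) F k)); last first.
  by apply: mono; exact: geq_minr.
elim: N => [|N IH]; first by rewrite big_geq// sumr_ge0.
rewrite big_nat_recr//=; case: ifPn => h.
  have -> : minn (N.+1 + i0) N' = (N + i0).+1 by lia.
  rewrite (big_nat_recr (N + i0).+1)//= addSn lerD2r.
  by rewrite (le_trans IH)// mono//; lia.
by rewrite addr0 (le_trans IH)// mono//; lia.
Qed.

End sums.

Section cover_integral.
Context {R : realType} (dsp : measure_display) (T : measurableType dsp).
Variable mu : {measure set T -> \bar R}.

Lemma integral_cover_le (I : eqType) (s : seq I) (A : I -> set T)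
    (g : T -> \bar R) (D : set T) :
  (forall i, measurable (A i)) -> measurable D ->
  measurable_fun [set: T] g -> (forall x, 0 <= g x)%E ->
  D `<=` [set x | exists2 i, i \in s & A i x] ->
  (\int[mu]_(x in D) g x <= \sum_(i <- s) \int[mu]_(x in A i) g x)%E.
Proof.
move=> mA + mg g0; elim: s D => [|i s IH] D mD sD.
  have -> : D = set0 by apply/seteqP; split => // x /sD [].
  by rewrite integral_set0 big_nil.
rewrite big_cons -(setUIDK D (A i)) ge0_integral_setU//=.
- apply: leeD.
    apply: ge0_subset_integral => //; first exact: measurableI.
    exact: measurable_funTS.
  apply: IH; first exact: measurableD.
  move=> x [/sD[j + Ajx] nAx]; rewrite inE => /orP[/eqP ji|js].
    by rewrite ji in Ajx.
  by exists j.
- exact: measurableI.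
- exact: measurableD.
- exact: measurable_funTS.
- by rewrite disj_set2E; apply/eqP/seteqP; split => // x [[_ ?] [_]].
Qed.

(** Integrate the pointwise bound on the number of sets containing a point. *)
Lemma measure_overlap_le (I : finType) (B : I -> set T) (W : set T) (M : nat) :
  (forall i, measurable (B i)) -> measurable W -> (forall i, B i `<=` W) ->
  (forall y, (\sum_(i : I) `[< B i y >] <= M)%N) ->
  (\sum_(i : I) mu (B i) <= M%:R%:E * mu W)%E.
Proof.
move=> mB mW BW hM.
have -> : (\sum_(i : I) mu (B i)
    = \sum_(i : I) \int[mu]_(y in W) (\1_(B i) y)%:E)%E.
  apply: eq_bigr => i _; rewrite integral_indic//.
  by congr (mu _); rewrite setIidl.
rewrite -ge0_integral_sum//; last first.
  by move=> i; apply/measurable_EFinP; exact: measurable_indic.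
rewrite -integral_cst//; apply: ge0_le_integral => //.
- by move=> x _; apply: sume_ge0 => i _; rewrite lee_fin.
- apply: emeasurable_sum => i; apply/measurable_EFinP; exact: measurable_indic.
- move=> y _; rewrite sumEFin lee_fin/=.
  have -> : \sum_(i : I) \1_(B i) y = (\sum_(i : I) `[< B i y >])%N%:R :> R.
    by rewrite natr_sum; apply: eq_bigr => i _; rewrite indicE.
  by rewrite ler_nat.
Qed.

End cover_integral.

(** * Cubes, their measure and mean oscillation *)

Section boxes.
Context {R : realType} {d : nat}.

(** The set of points of a cube, for an arbitrary real side: centres and sides
    can then be changed without proving that the side is positive. *)
Definition box (x : 'rV[R]_d) (r : R) : set (euclidean R d) :=
  [set y : 'rV[R]_d | forall i : 'I_d, `|y ord0 i - x ord0 i| <= r / 2].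

Lemma csetE (Q : cube R d) : cset Q = box (ctr Q) (len Q).
Proof. by []. Qed.

Lemma box_compact x r : compact (box x r : set 'rV[R]_d).
Proof.
have -> : (box x r : set 'rV[R]_d) = [set v : 'rV[R]_d | forall i : 'I_d,
    (`[x ord0 i - r / 2, x ord0 i + r / 2]%classic : set R) (v ord0 i)].
  apply/seteqP; split => y h i; have := h i; rewrite /= in_itv/= ler_norml.
    by move=> /andP[? ?]; apply/andP; split; lra.
  by move=> /andP[? ?]; apply/andP; split; lra.
apply: (@rV_compact R d
  (fun i => `[x ord0 i - r / 2, x ord0 i + r / 2]%classic)).
by move=> i; exact: segment_compact.
Qed.

Lemma box_measurable x r : measurable (box x r).
Proof.
rewrite -(setCK (box x r)); apply: measurableC; apply: sub_sigma_algebra.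
apply: closed_openC; apply: compact_closed; last exact: box_compact.
exact: norm_hausdorff.
Qed.

Lemma box_sub (x y : 'rV[R]_d) r s :
  (forall i, `|x ord0 i - y ord0 i| <= (s - r) / 2) ->
  box x r `<=` box y s.
Proof.
move=> h z hz i; have := h i; have := hz i.
rewrite !ler_norml => /andP[? ?] /andP[? ?]; apply/andP; split; lra.
Qed.

(** The corners of the smaller cube lie in the larger one. *)
Lemma sub_box (x y : 'rV[R]_d) r s : 0 <= r -> box x r `<=` box y s ->
  forall i, `|x ord0 i - y ord0 i| <= (s - r) / 2.
Proof.
move=> r0 h i.
have h1 : box x r (\row_j (x ord0 j + r / 2)).
  by move=> j; rewrite mxE ler_norml; apply/andP; split; lra.
have h2 : box x r (\row_j (x ord0 j - r / 2)).
  by move=> j; rewrite mxE ler_norml; apply/andP; split; lra.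
have := h _ h1 i; have := h _ h2 i; rewrite !mxE !ler_norml.
by move=> /andP[? ?] /andP[? ?]; apply/andP; split; lra.
Qed.

Lemma cube_eq (Q S : cube R d) :
  ctr Q = ctr S -> len Q = len S -> Q = S.
Proof.
by case: Q S => [x r] [y s] /= -> /val_inj ->.
Qed.

End boxes.

Section cube_measure.
Context {R : realType} {d : nat}.
Variables (mu : {measure set (euclidean R d) -> \bar R}) (n C0 : R).
Hypothesis n0 : 0 <= n.
Hypothesis C00 : 0 < C0.
Hypothesis hgrowth : growth mu n C0.

Definition mbox (x : 'rV[R]_d) (r : R) : R := fine (mu (box x r)).

Lemma mu_box_lty x r : (mu (box x r) < +oo)%E.
Proof.
have h : box x r `<=` cset (Cube x (`|r| + 1)%:pos).
  by apply: box_sub => i; rewrite subrr normr0/=; have := ler_norm r; lra.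
apply: (@le_lt_trans _ _ (mu (cset (Cube x (`|r| + 1)%:pos)))).
  by apply: le_measure => //; rewrite inE; exact: box_measurable.
by apply: le_lt_trans (hgrowth _) _; rewrite ltry.
Qed.

Lemma mu_box_fin x r : mu (box x r) \is a fin_num.
Proof. by rewrite ge0_fin_numE// mu_box_lty. Qed.

Lemma mboxE x r : mu (box x r) = (mbox x r)%:E.
Proof. by rewrite fineK// mu_box_fin. Qed.

Lemma mbox_ge0 x r : 0 <= mbox x r.
Proof. exact: fine_ge0. Qed.

Lemma mbox_subset x y r s : box x r `<=` box y s -> mbox x r <= mbox y s.
Proof.
move=> h; rewrite -lee_fin -!mboxE.
by apply: le_measure => //; rewrite inE; exact: box_measurable.
Qed.

Lemma mbox_le (x y : 'rV[R]_d) r s :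
  (forall i, `|x ord0 i - y ord0 i| <= (s - r) / 2) ->
  mbox x r <= mbox y s.
Proof. by move=> /box_sub; exact: mbox_subset. Qed.

Lemma mbox_le_side x r s : r <= s -> mbox x r <= mbox x s.
Proof. by move=> rs; apply: mbox_le => i; rewrite subrr normr0; lra. Qed.

Lemma mbox_growth x r : 0 < r -> mbox x r <= C0 * r `^ n.
Proof.
move=> r0; rewrite -lee_fin -mboxE.
by have := hgrowth (Cube x (PosNum r0)).
Qed.

Lemma doublingE (alpha : {posnum R}) (beta : R) Q :
  doubling mu alpha beta Q <->
  mbox (ctr Q) (alpha%:num * len Q)
    <= beta * mbox (ctr Q) (len Q).
Proof.
by rewrite /doubling !csetE/= !mboxE -EFinM lee_fin.
Qed.

Section integrals.
Variable f : euclidean R d -> R.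
Hypothesis hf : Lloc mu f.

Lemma Lloc_integrable_box x r : mu.-integrable (box x r) (EFin \o f).
Proof. by case: hf => _; apply; exact: box_compact. Qed.

Lemma integrable_box_cst x r (c : R) : mu.-integrable (box x r) (EFin \o cst c).
Proof.
apply: measurable_bounded_integrable.
- exact: box_measurable.
- exact: mu_box_lty.
- exact: measurable_cst.
- exact: bounded_cst.
Qed.

Lemma integrable_osc x r c :
  mu.-integrable (box x r) (EFin \o (fun y => `|f y - c|)).
Proof.
apply: (@integrable_norm _ _ _ _ _ (fun y => f y - c)).
apply: (@integrableB _ _ _ _ _ _ (EFin \o f) (EFin \o cst c)).
- exact: box_measurable.
- exact: Lloc_integrable_box.
- exact: integrable_box_cst.
Qed.

Definition osc x r c : R := \int[mu]_(y in box x r) `|f y - c|.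

Lemma oscE x r c :
  (osc x r c)%:E = (\int[mu]_(y in box x r) `|f y - c|%:E)%E.
Proof.
rewrite /osc /Rintegral fineK//.
apply: integrable_fin_num; first exact: box_measurable.
exact: integrable_osc.
Qed.

Lemma measurable_osc c :
  measurable_fun [set: euclidean R d] (fun y => `|f y - c|%:E).
Proof.
apply/measurable_EFinP; apply: measurableT_comp => //.
by apply: measurable_funB => //; case: hf.
Qed.

Lemma osc_subset x r y s c : box x r `<=` box y s -> osc x r c <= osc y s c.
Proof.
move=> h; rewrite -lee_fin !oscE.
apply: ge0_subset_integral => //; try exact: box_measurable.
by apply: measurable_funTS; exact: measurable_osc.
Qed.

Lemma osc_change x r c c' : osc x r c <= osc x r c' + `|c' - c| * mbox x r.
Proof.
rewrite -(Rintegral_cst mu (@box_measurable _ _ x r)).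
rewrite -RintegralD//; last 3 first.
- exact: box_measurable.
- exact: integrable_osc.
- exact: integrable_box_cst.
apply: le_Rintegral => //.
- exact: box_measurable.
- exact: integrable_osc.
- apply: (@integrableD _ _ _ _ _ _ (EFin \o (fun y => `|f y - c'|))
    (EFin \o cst `|c' - c|)).
  + exact: box_measurable.
  + exact: integrable_osc.
  + exact: integrable_box_cst.
- move=> y _; rewrite -[f y - c](_ : (f y - c') + (c' - c) = _); last by lra.
  exact: ler_normD.
Qed.

Lemma osc_null x r c : mbox x r = 0 -> osc x r c = 0.
Proof.
move=> h; apply: EFin_inj; rewrite oscE; apply: null_set_integral.
- exact: box_measurable.
- by apply: measurable_funTS; exact: measurable_osc.
- by rewrite /= mboxE h.
Qed.

Lemma mean_sub_le Q c : 0 < msr mu Q ->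
  `|mean mu Q f - c| <= (msr mu Q)^-1 * osc (ctr Q) (len Q) c.
Proof.
move=> Q0.
have hb := @box_measurable _ _ (ctr Q) (len Q).
have hi := Lloc_integrable_box (ctr Q) (len Q).
have hc := integrable_box_cst (ctr Q) (len Q) c.
have -> : mean mu Q f - c = (msr mu Q)^-1 * \int[mu]_(y in cset Q) (f y - c).
  rewrite RintegralB// Rintegral_cst// mulrBr; congr (_ - _).
  by rewrite -/(msr mu Q) mulrCA mulVf ?mulr1// gt_eqF.
rewrite normrM gtr0_norm ?invr_gt0// ler_pM2l ?invr_gt0//.
apply: le_normr_Rintegral => //.
exact: (@integrableB _ _ _ _ _ _ (EFin \o f) (EFin \o cst c)).
Qed.

Lemma osc_cover (I : finType) (z : I -> 'rV[R]_d) (s : R) x r c :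
  box x r `<=` [set y | exists i, box (z i) s y] ->
  osc x r c <= \sum_i osc (z i) s c.
Proof.
move=> h; rewrite -lee_fin oscE -sumEFin.
under eq_bigr do rewrite oscE.
apply: (@integral_cover_le _ _ _ mu I (index_enum I)
  (fun i => box (z i) s)) => //.
- by move=> i; exact: box_measurable.
- exact: box_measurable.
- exact: measurable_osc.
- by move=> y /h[i hi]; exists i => //; rewrite mem_index_enum.
Qed.

End integrals.

Lemma mbox_cover (I : finType) (z : I -> 'rV[R]_d) (s : R) x r :
  box x r `<=` [set y | exists i, box (z i) s y] ->
  mbox x r <= \sum_i mbox (z i) s.
Proof.
move=> h.
have E y t : (mbox y t)%:E = (\int[mu]_(_ in box y t) 1)%E.
  by rewrite -mboxE integral_cst ?mul1e//; exact: box_measurable.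
rewrite -lee_fin E -sumEFin; under eq_bigr do rewrite E.
apply: (@integral_cover_le _ _ _ mu I (index_enum I)
  (fun i => box (z i) s)) => //.
- by move=> i; exact: box_measurable.
- exact: box_measurable.
- by move=> y /h[i hi]; exists i => //; rewrite mem_index_enum.
Qed.

Lemma mbox_overlap (I : finType) (z : I -> 'rV[R]_d) (s : R) x r (M : nat) :
  (forall i, box (z i) s `<=` box x r) ->
  (forall y, (\sum_(i : I) `[< box (z i) s y >] <= M)%N) ->
  \sum_i mbox (z i) s <= M%:R * mbox x r.
Proof.
move=> h hM; rewrite -lee_fin -sumEFin EFinM -mboxE.
under eq_bigr do rewrite -mboxE.
apply: measure_overlap_le => //; first by move=> i; exact: box_measurable.
exact: box_measurable.
Qed.

End cube_measure.

(** * Covering a cube by smaller ones *)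

(** Bernoulli's inequality. *)
Lemma expr_unbounded (R : realType) (a M : R) : 1 < a ->
  exists N, forall k, (N <= k)%N -> M < a ^+ k.
Proof.
move=> a1.
have bern k : 1 + k%:R * (a - 1) <= a ^+ k.
  elim: k => [|k IH]; first by rewrite mul0r addr0 expr0.
  rewrite exprS -natr1; have : a * (1 + k%:R * (a - 1)) <= a * a ^+ k.
    by rewrite ler_pM2l//; lra.
  have : 0 <= k%:R * (a - 1) * (a - 1) by rewrite !mulr_ge0//; lra.
  by lra.
exists (Num.truncn (`|M| / (a - 1))).+1 => k hk.
apply: lt_le_trans (bern k).
have h1 : `|M| / (a - 1) < k%:R.
  by apply: (lt_le_trans (truncnS_gt _)); rewrite ler_nat.
have h2 : `|M| < k%:R * (a - 1) by rewrite -ltr_pdivrMr//; lra.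
by have := ler_norm M; lra.
Qed.

Lemma window_count_le (P : pred nat) (h N : nat) :
  (forall a b, P a -> P b -> (a <= b)%N -> (b - a <= h)%N) ->
  (\sum_(a < N) P a <= h.+1)%N.
Proof.
move=> hP; rewrite -(big_mkord xpredT (fun a => nat_of_bool (P a))).
elim: N => [|N IH]; first by rewrite big_geq.
case: (boolP (P N)) => PN; last by rewrite big_nat_recr//= (negbTE PN) addn0.
rewrite (@big_cat_nat _ _ _ (N - h))//=; last by lia.
rewrite big_nat_cond big1 ?add0n; last first.
  move=> a; rewrite andbT => ha; case Pa: (P a) => //.
  by have := hP _ _ Pa PN; lia.
apply: (@leq_trans (\sum_(N - h <= a < N.+1) 1)%N).
  by apply: leq_sum => a _; case: (P a).
by rewrite sum_nat_const_nat muln1; lia.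
Qed.

Section grid.
Context {R : realType} {d : nat}.

(** The last column is moved back so that all the cubes stay inside the large
    one when s does not divide L. *)
Definition grid_offset (L s : R) (a : nat) : R := Num.min (a%:R * s) (L - s).

Definition grid (x : 'rV[R]_d) (L s : R)
    (i : {ffun 'I_d -> 'I_(Num.truncn (L / s)).+1}) : 'rV[R]_d :=
  \row_j (x ord0 j - L / 2 + s / 2 + grid_offset L s (i j)).

Lemma grid_center_close x (L s : R) i j : 0 < s -> s <= L ->
  `|@grid x L s i ord0 j - x ord0 j| <= (L - s) / 2.
Proof.
move=> s0 sL; rewrite mxE /grid_offset.
have h0 : 0 <= (i j)%:R * s by rewrite mulr_ge0// ltW.
by case: (leP ((i j)%:R * s) (L - s)) => h; rewrite ler_norml;
  apply/andP; split; lra.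
Qed.

Lemma grid_covers x (L s : R) : 0 < s -> s <= L ->
  box x L `<=` [set y | exists i, box (@grid x L s i) s y].
Proof.
move=> s0 sL y hy.
pose t (j : 'I_d) : R := y ord0 j - x ord0 j + L / 2.
have ht j : 0 <= t j <= L.
  by have := hy j; rewrite /t ler_norml => /andP[? ?]; apply/andP; split; lra.
have hk j : (Num.truncn (t j / s) < (Num.truncn (L / s)).+1)%N.
  rewrite ltnS; apply: le_truncn; rewrite ler_pM2r ?invr_gt0//.
  by case/andP: (ht j).
exists [ffun j => Ordinal (hk j)] => j; rewrite mxE ffunE /= /grid_offset.
have /andP[t0 tL] := ht j.
have /andP[] := truncn_itv (divr_ge0 t0 (ltW s0)).
rewrite ler_pdivlMr// ltr_pdivrMr// -natr1 => h1 h2.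
have yE : y ord0 j = t j + x ord0 j - L / 2 by rewrite /t; lra.
rewrite yE; set a := (Num.truncn (t j / s))%:R in h1 h2 *.
by case: (leP (a * s) (L - s)) => h; rewrite ler_norml;
  apply/andP; split; lra.
Qed.

Lemma card_grid (L s : R) : 0 < s -> s <= L ->
  (#|{ffun 'I_d -> 'I_(Num.truncn (L / s)).+1}|)%:R <= (2 * (L / s)) ^+ d :> R.
Proof.
move=> s0 sL; rewrite card_ffun !card_ord natrX lerXn2r ?nnegrE//.
  by rewrite mulr_ge0// divr_ge0// ?(ltW s0)//; lra.
have h : 1 <= L / s by rewrite ler_pdivlMr// mul1r.
have /andP[h1 _] := @truncn_itv R (L / s) ltac:(lra).
by rewrite -natr1; lra.
Qed.

(** The cubes containing y are those whose index satisfies one condition per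
    coordinate, so that their number is a product of one-dimensional counts.
    In each coordinate, the indices of the regular columns lie in a window of
    length H; the last column may add one. *)
Lemma grid_overlap (H : R) : 0 <= H ->
  exists M : nat, forall (x : 'rV[R]_d) (L s : R) y,
  0 < s -> s <= L ->
  (\sum_i `[< box (@grid x L s i) (H * s) y >] <= M)%N.
Proof.
move=> H0; exists ((Num.truncn H).+2 ^ d)%N => x L s y s0 sL.
set k := Num.truncn (L / s).
pose F (j : 'I_d) (a : 'I_k.+1) : nat :=
  `|y ord0 j - (x ord0 j - L / 2 + s / 2 + grid_offset L s a)| <= H * s / 2.
apply: (@leq_trans (\sum_(i : {ffun 'I_d -> 'I_k.+1}) \prod_j F j (i j))%N).
  apply: leq_sum => i _; case: asboolP => //= hi.
  by rewrite big1// => j _; have := hi j; rewrite /F mxE => ->.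
rewrite -(bigA_distr_bigA F).
apply: (@leq_trans (\prod_(j < d) (Num.truncn H).+2)%N); last first.
  by rewrite prod_nat_const card_ord.
apply: leq_prod => j _; rewrite big_ord_recr/=.
rewrite -(addn1 _.+1) leq_add//; last by rewrite /F; case: (_ <= _).
pose P (a : nat) :=
  `|y ord0 j - (x ord0 j - L / 2 + s / 2 + a%:R * s)| <= H * s / 2.
have E : (\sum_(a < k) F j (widen_ord (leqnSn k) a) = \sum_(a < k) P a)%N.
  apply: eq_bigr => a _; rewrite /F /P /grid_offset/= min_l//.
  have : a.+1%:R <= L / s.
    apply: (@le_trans _ _ k%:R); first by rewrite ler_nat ltn_ord.
    by have /andP[] := @truncn_itv R (L / s) ltac:(apply: divr_ge0; lra).
  by rewrite ler_pdivlMr// -natr1; lra.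
rewrite E; apply: window_count_le => a b; rewrite /P !ler_norml.
move=> /andP[a1 a2] /andP[b1 b2] ab.
have : (b - a)%:R <= H.
  by rewrite -(ler_pM2r s0) natrB//; lra.
move=> h; have /andP[_ h2] := truncn_itv H0.
by have := le_lt_trans h h2; rewrite ltr_nat ltnS.
Qed.

End grid.

(** * Doubling cubes above and below a given cube *)

Section doubling_cubes.
Context {R : realType} {d : nat}.
Variables (mu : {measure set (euclidean R d) -> \bar R}) (n C0 : R).
Hypothesis n0 : 0 <= n.
Hypothesis nd : n <= d%:R.
Hypothesis C00 : 0 < C0.
Hypothesis hgrowth : growth mu n C0.
Variables (alpha : {posnum R}) (beta : R).
Hypothesis alpha1 : 1 < alpha%:num.
Hypothesis alpha_beta : alpha%:num ^+ d < beta.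

Local Notation m := (mbox mu).
Local Notation al := (alpha%:num).

Lemma beta_gt1 : 1 < beta.
Proof. by apply: le_lt_trans alpha_beta; rewrite exprn_ege1// ltW. Qed.

Lemma powR_alpha_lt_beta : al `^ n < beta.
Proof.
apply: le_lt_trans alpha_beta; rewrite -powR_mulrn//.
by apply: ler_powR => //; exact: ltW.
Qed.

(** The room left by the strict inequality alpha^n <= alpha^d < beta. *)
Lemma decay_exponent_ex : exists2 e : R, 0 < e & al `^ (n + e) = beta.
Proof.
have la : 0 < ln al by rewrite ln_gt0.
have b0 : 0 < beta by have := beta_gt1; lra.
exists (ln beta / ln al - n).
  rewrite subr_gt0 ltr_pdivlMr// -ln_powR ltr_ln ?posrE ?powR_gt0//.
  exact: powR_alpha_lt_beta.
by rewrite addrC subrK /powR gt_eqF// divfK ?gt_eqF// lnK// posrE.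
Qed.

(** Otherwise the measure of the dilates would grow at least like powers of
    beta, in contradiction with the growth condition. *)
Lemma positive_doubling_ex x (l : R) (j : nat) :
  0 < l -> 0 < m x (al ^+ j * l) ->
  exists k, 0 < m x (al ^+ k * l) /\
    m x (al ^+ k.+1 * l) <= beta * m x (al ^+ k * l).
Proof.
move=> l0 mj0; apply: contrapT => hno.
have b1 := beta_gt1.
have grow i : beta ^+ i * m x (al ^+ j * l) <= m x (al ^+ (i + j) * l).
  elim: i => [|i IH]; first by rewrite expr0 mul1r.
  have mi0 : 0 < m x (al ^+ (i + j) * l).
    by apply: lt_le_trans IH; rewrite mulr_gt0// exprn_gt0//; lra.
  rewrite exprS -mulrA addSn; apply: ltW.
  apply: (@le_lt_trans _ _ (beta * m x (al ^+ (i + j) * l))).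
    by rewrite ler_pM2l//; lra.
  by rewrite ltNge; apply/negP => h; apply: hno; exists (i + j)%N.
have g0 : 0 < al `^ n by rewrite powR_gt0.
have g1 : 1 < beta / al `^ n by rewrite ltr_pdivlMr// mul1r powR_alpha_lt_beta.
have B0 : 0 < (al ^+ j * l) `^ n by rewrite powR_gt0// mulr_gt0// exprn_gt0.
have [N /(_ N (leqnn N))] := expr_unbounded
  (C0 * (al ^+ j * l) `^ n / m x (al ^+ j * l)) g1.
apply/negP; rewrite -leNgt expr_div_n ler_pdivlMr// mulrAC.
rewrite ler_pdivrMr ?exprn_gt0//.
apply: (le_trans (grow N)).
apply: (le_trans (mbox_growth hgrowth _ _)).
  by rewrite mulr_gt0// exprn_gt0.
rewrite exprD -mulrA powRM ?exprn_ge0 ?mulr_ge0 ?(ltW l0)//.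
rewrite -powR_mulrn// -powRrM (mulrC N%:R) powRrM powR_mulrn ?powR_ge0//.
by rewrite -mulrA (mulrC ((al ^+ j * l) `^ n)).
Qed.

Lemma is_down_ex P :
  (exists2 N, (0 < N)%N & m (ctr P) (al * (al ^- N * len P))
      <= beta * m (ctr P) (al ^- N * len P)) ->
  exists2 P', is_down mu alpha beta P P' & len P' <= len P / al.
Proof.
move=> [N N0 hN].
have ex : exists N, `[< (0 < N)%N /\
    doubling mu alpha beta (dilate (al ^- N)%:pos P) >].
  by exists N; apply/asboolP; split => //; apply/(doublingE hgrowth).
case: (ex_minnP ex) => k /asboolP[k0 hk] kmin.
exists (dilate (al ^- k)%:pos P) => /=.
  exists k; split => // i /andP[i0 ik] hi.
  have /kmin : `[< (0 < i)%N /\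
    doubling mu alpha beta (dilate (al ^- i)%:pos P) >] by apply/asboolP.
  by rewrite leqNgt ik.
rewrite mulrC ler_pM2l// lef_pV2 ?posrE ?exprn_gt0//.
by rewrite -[leLHS]expr1 ler_weXn2l// ltW.
Qed.

(** Suppose that no cube of side L whose centre z is close enough to that of S
    has a doubling cube below it.  Then m(z, alpha^-N L) is at most a constant
    times beta^-N for all these z, whereas (const * alpha^N)^d of these cubes
    suffice to cover a neighbourhood of the centre of S.  As alpha^d < beta, the
    neighbourhood is null.  But a cube with a null dilate is doubling. *)
Lemma enclosing_cube_with_down (S : cube R d) (L : {posnum R}) :
  len S < L%:num -> exists P P', [/\ cset S `<=` cset P, len P = L%:num,
    is_down mu alpha beta P P' & len P' <= L%:num / al].
Proof.
move=> SL; apply: contrapT => hno.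
have b1 := beta_gt1.
set x := ctr S; set D := L%:num - len S.
have D0 : 0 < D by rewrite subr_gt0.
have nodbl (z : 'rV[R]_d) :
    (forall i, `|z ord0 i - x ord0 i| <= D / 2) -> forall N,
    beta * m z (al ^- N.+1 * L%:num) < m z (al ^- N * L%:num).
  move=> hz N; rewrite ltNge; apply/negP => h; apply: hno.
  have [] := @is_down_ex (Cube z L).
    exists N.+1 => //=; apply: le_trans h.
    by rewrite mulrA exprS invfM mulrA divff// mul1r.
  move=> P' hP' lP'; exists (Cube z L), P'; split => //.
  by apply: box_sub => i /=; rewrite distrC.
have small (z : 'rV[R]_d) :
    (forall i, `|z ord0 i - x ord0 i| <= D / 2) -> forall N,
    m z (al ^- N * L%:num) <= C0 * L%:num `^ n / beta ^+ N.
  move=> hz; elim=> [|N IH].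
    by rewrite !expr0 invr1 mul1r mulr1; exact: (mbox_growth hgrowth).
  have := le_trans (ltW (nodbl z hz N)) IH.
  rewrite -ler_pdivlMl; last by lra.
  by move=> h; apply: (le_trans h); rewrite exprS invfM mulrCA mulrA lexx.
have hx : forall i, `|x ord0 i - x ord0 i| <= D / 2.
  by move=> i; rewrite subrr normr0; lra.
have [N1 hN1] := expr_unbounded (L%:num / D) alpha1.
have sD N : (N1 <= N)%N -> al ^- N * L%:num <= D.
  move=> /hN1; rewrite ltr_pdivrMr// => h.
  by rewrite mulrC ler_pdivrMr ?exprn_gt0// mulrC ltW.
have mD N : (N1 <= N)%N -> m x D <=
    (2 * D / L%:num) ^+ d * (C0 * L%:num `^ n) * (al ^+ d / beta) ^+ N.
  move=> hN; set s := al ^- N * L%:num.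
  have s0 : 0 < s by rewrite mulr_gt0// invr_gt0 exprn_gt0.
  apply: (le_trans (mbox_cover hgrowth (grid_covers s0 (sD _ hN)))).
  apply: (@le_trans _ _ (\sum_(i : {ffun 'I_d -> 'I_(Num.truncn (D / s)).+1})
      (C0 * L%:num `^ n / beta ^+ N))).
    apply: ler_sum => i _; apply: small => j.
    by have := grid_center_close x i j s0 (sD _ hN); lra.
  rewrite sumr_const -[_ *+ _]mulr_natl.
  apply: (@le_trans _ _ ((2 * (D / s)) ^+ d * (C0 * L%:num `^ n / beta ^+ N))).
    rewrite ler_wpM2r ?card_grid ?sD//.
    apply: divr_ge0; first by rewrite mulr_ge0 ?powR_ge0// ltW.
    by rewrite exprn_ge0//; lra.
  rewrite /s invfM invrK.
  have -> : 2 * (D * (al ^+ N * L%:num^-1)) = 2 * D / L%:num * al ^+ N by ring.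
  rewrite exprMn exprAC [(al ^+ d / beta) ^+ N]expr_div_n.
  by rewrite mulrACA.
have mD0 : m x D = 0.
  apply/eqP; rewrite eq_le mbox_ge0 andbT leNgt; apply/negP => h.
  set A := (2 * D / L%:num) ^+ d * (C0 * L%:num `^ n) in mD.
  have q1 : 1 < beta / al ^+ d by rewrite ltr_pdivlMr ?exprn_gt0// mul1r.
  have [N2 hN2] := expr_unbounded (A / m x D) q1.
  have := mD _ (leq_maxl N1 N2); apply/negP; rewrite -ltNge.
  have := hN2 _ (leq_maxr N1 N2); set N := maxn _ _.
  rewrite ltr_pdivrMr// => h3.
  have -> : (al ^+ d / beta) ^+ N = ((beta / al ^+ d) ^+ N)^-1.
    by rewrite -exprVn invf_div.
  by rewrite ltr_pdivrMr ?exprn_gt0 ?(lt_trans _ q1)// mulrC.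
have := nodbl x hx N1.
have -> : m x (al ^- N1 * L%:num) = 0.
  apply/eqP; rewrite eq_le mbox_ge0 andbT -mD0.
  by apply: (mbox_le_side hgrowth); exact: sD.
by apply/negP; rewrite -leNgt mulr_ge0 ?mbox_ge0//; lra.
Qed.

(** Each step down the chain divides the measure by at least
    beta = alpha^(n+e), while r^n is only divided by alpha^n: the density m(x,r)/r^n gains a factor
    alpha^-e.  Beyond the top of the chain the bound is the growth condition. *)
Lemma decay_le (e : R) x (l : R) (j : nat) :
  0 < e -> al `^ (n + e) = beta -> 0 < l ->
  (forall k, (k < j)%N ->
    beta * m x (al ^+ k * l) <= m x (al ^+ k.+1 * l)) ->
  forall r : R, l <= r ->
  m x r <= C0 * beta * (r `^ n * (r / (al ^+ j * l)) `^ e).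
Proof.
move=> e0 ae l0; have b1 := beta_gt1.
set p := n + e.
have p0 : 0 < p by rewrite /p ltr_wpDl.
have B0 k : 0 < al ^+ k * l by rewrite mulr_gt0// exprn_gt0.
(* the factor beta pays for rounding r up to the next dilate in the chain *)
move=> hj; have core r : l <= r -> r <= al ^+ j * l ->
    m x r <= beta * (r / (al ^+ j * l)) `^ p * m x (al ^+ j * l).
  elim: j hj => [|j IH] hj lr rj.
    have -> : r = l by apply/eqP; rewrite eq_le lr andbT -[l]mul1r -(expr0 al).
    rewrite expr0 mul1r divff ?gt_eqF// powR1 mulr1.
    by rewrite ler_peMl ?mbox_ge0//; lra.
  have r0 : 0 < r by lra.
  have [rj'|rj'] := leP r (al ^+ j * l).
    apply: (le_trans (IH (fun k kj => hj k (leqW kj)) lr rj')).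
    have -> : r / (al ^+ j * l) = al * (r / (al ^+ j.+1 * l)).
      by rewrite exprS; field; rewrite !gt_eqF ?exprn_gt0.
    rewrite powRM ?divr_ge0 ?(ltW r0) ?(ltW (B0 _))// ae.
    rewrite -mulrA [leRHS]mulrAC -mulrA mulrA.
    rewrite -!mulrA ler_pM2l; last by lra.
    rewrite mulrCA [leRHS]mulrC ler_wpM2l ?powR_ge0//.
    exact: hj.
  apply: (le_trans (mbox_le_side hgrowth x rj)).
  rewrite ler_peMl ?mbox_ge0// -[X in X * _]ae -powRM//; last first.
    by rewrite divr_ge0// ltW.
  rewrite -[leLHS](_ : (1 : R) `^ p = 1); last by rewrite powR1.
  apply: ge0_ler_powR; rewrite ?nnegrE//; first exact: ltW.
    by rewrite mulr_ge0// divr_ge0// ltW.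
  rewrite mulrA ler_pdivlMr// mul1r exprS -mulrA ler_pM2l//; exact: ltW.
move=> r lr; have r0 : 0 < r by lra.
set b := al ^+ j * l; have b0 : 0 < b by exact: B0.
have [rb|br] := leP r b.
  apply: (le_trans (core r lr rb)).
  apply: (@le_trans _ _ (beta * (r / b) `^ p * (C0 * b `^ n))).
    rewrite ler_wpM2l ?mulr_ge0 ?powR_ge0//; first by lra.
    exact: (mbox_growth hgrowth).
  rewrite /p powRD; last by rewrite gt_eqF// mulf_neq0// gt_eqF// invr_gt0.
  have -> : r `^ n = (r / b) `^ n * b `^ n.
    by rewrite -powRM ?divfK ?gt_eqF// ?ltW// divr_gt0.
  by rewrite le_eqVlt; apply/orP; left; apply/eqP; ring.
apply: (le_trans (mbox_growth hgrowth x r0)).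
rewrite -mulrA ler_pM2l// mulrCA ler_peMr ?powR_ge0//.
have : 1 <= (r / b) `^ e.
  rewrite -[leLHS](_ : (1 : R) `^ e = 1); last by rewrite powR1.
  apply: ge0_ler_powR; rewrite ?nnegrE//; first exact: ltW.
    by rewrite divr_ge0// ltW.
  by rewrite ler_pdivlMr// mul1r ltW.
move=> h; rewrite -[leLHS]mulr1; apply: ler_pM => //; lra.
Qed.

End doubling_cubes.

(** * Integrals over large cubes *)

Section large_cubes.
Context {R : realType} {d : nat}.
Variables (mu : {measure set (euclidean R d) -> \bar R}) (n C0 : R).
Hypothesis hgrowth : growth mu n C0.

Local Notation m := (mbox mu).

Lemma osc0E (f : euclidean R d -> R) x r :
  \int[mu]_(y in box x r) `|f y| = osc mu f x r 0.
Proof. by apply: eq_Rintegral => y _; rewrite subr0. Qed.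

(** The grid cubes have side 1 and lie in the cube of side L.  The hypothesis
    eta1 - 1 <= (eta - 1) L says that their dilates by eta1 lie in its dilate by
    eta; for L > 1 it leaves room for some eta1 > eta.  The constant is uniform
    as long as eta1 is bounded. *)
Lemma large_cube_osc_le (H : R) : 0 <= H ->
  exists2 M : R, 0 <= M & forall (f : euclidean R d -> R) (A eta eta1 : R),
    Lloc mu f -> 0 <= A -> eta1 <= H ->
    (forall z, osc mu f z 1 0 <= A * m z eta1) ->
    forall x L, 1 <= L -> eta1 - 1 <= (eta - 1) * L ->
    osc mu f x L 0 <= M * A * m x (eta * L).
Proof.
move=> H0; have [M hM] := @grid_overlap R d H H0.
exists M%:R => // f A eta eta1 hf A0 eta1H hunit x L L1 hL.
apply: (le_trans (osc_cover hgrowth hf _ (grid_covers ltr01 L1))).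
apply: (@le_trans _ _ (A * \sum_i m (@grid _ _ x L 1 i) eta1)).
  by rewrite mulr_sumr; apply: ler_sum => i _; exact: hunit.
rewrite (mulrC _ A) -mulrA ler_wpM2l//.
apply: (mbox_overlap hgrowth) => [i|y].
  apply: box_sub => j; apply: (le_trans (grid_center_close _ _ _ ltr01 L1)).
  by lra.
apply: leq_trans (hM x L 1 y ltr01 L1); apply: leq_sum => i _.
case: asboolP => // hy; case: asboolP => // -[] j.
by apply: (le_trans (hy j)); lra.
Qed.

End large_cubes.

(** * The coefficients K *)

Section coefficients.
Context {R : realType} {d : nat}.
Variables (mu : {measure set (euclidean R d) -> \bar R}) (n C0 : R).
Hypothesis n0 : 0 <= n.
Hypothesis hgrowth : growth mu n C0.
Variable e : R.
Hypothesis e0 : 0 < e.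
Implicit Types Q S T P U : cube R d.

Local Notation m := (mbox mu).

Lemma dyadic_steps_ge Q S : len S <= 2 ^+ dyadic_steps Q S * len Q.
Proof. by rewrite /dyadic_steps; case: ex_minnP. Qed.

Lemma dyadic_steps_lt Q S k : (0 < k)%N -> (k < (dyadic_steps Q S).+1)%N ->
  2 ^+ k * len Q < 2 * len S.
Proof.
case: k => // k _; rewrite ltnS /dyadic_steps; case: ex_minnP => N _ Nmin kN.
rewrite exprS -mulrA ltr_pM2l// ltNge; apply/negP => /Nmin.
by rewrite leqNgt kN.
Qed.

Lemma KcoefE Q S : Kcoef mu n Q S = 1 + \sum_(1 <= k < (dyadic_steps Q S).+1)
  m (ctr Q) (2 ^+ k * len Q) / (2 ^+ k * len Q) `^ n.
Proof. by []. Qed.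

Lemma Kcoef_ge1 Q S : 1 <= Kcoef mu n Q S.
Proof.
rewrite KcoefE lerDl; apply: sumr_ge0 => k _.
by rewrite divr_ge0 ?powR_ge0 ?mbox_ge0.
Qed.

Lemma Kcoef_id Q : Kcoef mu n Q Q = 1.
Proof.
rewrite KcoefE big_geq ?addr0//= ltnS /dyadic_steps.
by case: ex_minnP => N _; apply; rewrite /= expr0 mul1r.
Qed.

Lemma density_le x (r A t : R) : 0 < r -> m x r <= A * (r `^ n * t) ->
  m x r / r `^ n <= A * t.
Proof. by move=> r0 h; rewrite ler_pdivrMr ?powR_gt0// -mulrA (mulrC t). Qed.

Lemma powR_rescale (r b c : R) : 0 <= r -> 0 < b -> 0 < c ->
  (r / b) `^ e = c `^ e * (r / (c * b)) `^ e.
Proof.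
move=> r0 b0 c0; rewrite -powRM ?divr_ge0 ?mulr_ge0 ?(ltW c0) ?(ltW b0)//.
by congr (_ `^ _); field; rewrite !gt_eqF.
Qed.

(** If the density decays at a scale b comparable to the side of T, the sum in
    K is dominated by a geometric series. *)
Lemma Kcoef_bounded (A lambda : R) : 0 <= A -> 0 < lambda ->
  exists2 K : R, 0 <= K & forall Q T (b : R), 0 < b -> len T <= lambda * b ->
    (forall r, len Q <= r -> m (ctr Q) r <= A * (r `^ n * (r / b) `^ e)) ->
    Kcoef mu n Q T <= K.
Proof.
move=> A0 l0; have [G G0 hG] := geometric_sum_bounded e0.
have B0 : 0 <= A * (2 * lambda) `^ e by rewrite mulr_ge0 ?powR_ge0.
exists (1 + A * (2 * lambda) `^ e * G); first by rewrite addr_ge0// mulr_ge0.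
move=> Q T b b0 Tb hb; rewrite KcoefE lerD2l.
have c0 : 0 < 2 * lambda * b by rewrite !mulr_gt0.
apply: (le_trans _ (ler_wpM2l B0 (hG (len Q) _ (dyadic_steps Q T) _ c0))) => //.
rewrite mulr_sumr; apply: ler_sum_nat => k /andP[k0 kN].
have r0 : 0 < 2 ^+ k * len Q by rewrite mulr_gt0// exprn_gt0.
have rT := dyadic_steps_lt k0 kN.
rewrite ifT; last by rewrite (le_trans (ltW rT))// -mulrA ler_pM2l.
rewrite -[leRHS]mulrA -powR_rescale ?(ltW r0)// ?mulr_gt0//.
apply: density_le => //; apply: hb.
by rewrite ler_peMl// exprn_ege1// ler1n.
Qed.

(** The k-th term of K for (S,T), of side r = 2^k l(S), is estimated
    in one of three ways.  If r < l(U), it is comparable to the term of K for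
    (Q,U) of index k + i0, where 2^i0 Q is the first dyadic dilate of Q
    containing S.  If l(U) <= r < l(P), the density decays at the scale of P.
    If l(P) <= r, the cube lies in the cube of side 2r concentric with P, whose
    density decays at the scale of T. *)
Lemma Kcoef_compare (A1 A2 : R) : 0 <= A1 -> 0 <= A2 ->
  exists2 K : R, 0 <= K & forall Q U S P T,
    ctr S = ctr Q -> len Q <= len S -> cset S `<=` cset P ->
    (forall r, len U <= r -> r < len P ->
       m (ctr Q) r <= A1 * (r `^ n * (r / len P) `^ e)) ->
    (forall r, len P <= r -> m (ctr P) r <= A2 * (r `^ n * (r / len T) `^ e)) ->
    Kcoef mu n S T <= K * Kcoef mu n Q U.
Proof.
move=> A10 A20; have [G G0 hG] := geometric_sum_bounded e0.
have B20 : 0 <= A2 * 2 `^ n * 4 `^ e by rewrite !mulr_ge0 ?powR_ge0.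
exists (1 + (A2 * 2 `^ n * 4 `^ e + A1) * G + 2 `^ n).
  by rewrite !addr_ge0 ?mulr_ge0 ?powR_ge0 ?addr_ge0.
move=> Q U S P T SQ lQS SP h1 h2.
pose N := dyadic_steps S T; pose NQ := dyadic_steps Q U.
pose F k := m (ctr Q) (2 ^+ k * len Q) / (2 ^+ k * len Q) `^ n.
have F0 k : 0 <= F k by rewrite divr_ge0 ?powR_ge0 ?mbox_ge0.
pose i0 := dyadic_steps Q S.
have i0ge : len S <= 2 ^+ i0 * len Q := dyadic_steps_ge Q S.
have i0le : 2 ^+ i0 * len Q <= 2 * len S.
  have [i00|i00] := posnP i0.
    by rewrite i00 expr0 mul1r (le_trans lQS)// ler_peMl// ler1n.
  by apply/ltW/dyadic_steps_lt.
pose g b k : R := if 2 ^+ k * len S <= b then (2 ^+ k * len S / b) `^ e else 0.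
have g0 b k : 0 <= g b k by rewrite /g; case: ifP => // _; exact: powR_ge0.
pose F' k : R := if (k + i0 <= NQ)%N then F (k + i0)%N else 0.
have F'0 k : 0 <= F' k by rewrite /F'; case: ifP.
have term k : (0 < k)%N -> (k < N.+1)%N ->
    m (ctr S) (2 ^+ k * len S) / (2 ^+ k * len S) `^ n
    <= A2 * 2 `^ n * 4 `^ e * g (2 * len T) k + A1 * g (len P) k
       + 2 `^ n * F' k.
  move=> k0 kN; set r := 2 ^+ k * len S.
  have r0 : 0 < r by rewrite mulr_gt0// exprn_gt0.
  have rT : r < 2 * len T := dyadic_steps_lt k0 kN.
  have p1 : 0 <= A2 * 2 `^ n * 4 `^ e * g (2 * len T) k by rewrite mulr_ge0.
  have p2 : 0 <= A1 * g (len P) k by rewrite mulr_ge0.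
  have p3 : 0 <= 2 `^ n * F' k by rewrite mulr_ge0 ?powR_ge0.
  have [Pr|rP] := leP (len P) r.
    apply: (@le_trans _ _ (A2 * 2 `^ n * 4 `^ e * g (2 * len T) k)).
    2: by rewrite -addrA lerDl addr_ge0.
    rewrite /g -/r ifT ?(ltW rT)//; apply: density_le => //.
    apply: (@le_trans _ _ (m (ctr P) (2 * r))).
      apply: (mbox_le hgrowth) => i.
      have S0 : 0 < len S by [].
      have SPi := sub_box (ltW S0) SP i.
      by rewrite SQ in SPi *; apply: (le_trans SPi); lra.
    apply: (le_trans (h2 (2 * r) _)); first by have : 0 < r := r0; lra.
    rewrite powRM// ?(ltW r0)//.
    rewrite (@powR_rescale (2 * r) (len T) 4) ?mulr_ge0 ?(ltW r0)//.
    have -> : 2 * r / (4 * len T) = r / (2 * len T).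
      by field; rewrite gt_eqF.
    by rewrite le_eqVlt; apply/orP; left; apply/eqP; ring.
  have [Ur|rU] := leP (len U) r.
    apply: (@le_trans _ _ (A1 * g (len P) k)).
    2: by rewrite addrAC lerDr addr_ge0.
    rewrite /g -/r ifT ?(ltW rP)//; apply: density_le => //.
    by rewrite SQ; exact: h1.
  apply: (@le_trans _ _ (2 `^ n * F' k)).
    2: by rewrite lerDr addr_ge0.
  have kN' : (k + i0 <= NQ)%N.
    rewrite leqNgt; apply/negP => h.
    have : 2 ^+ NQ * len Q <= r.
      rewrite -(ler_pM2l (ltr0n R 2)) mulrA -exprS.
      apply: (@le_trans _ _ (2 ^+ (k + i0) * len Q)).
        by rewrite ler_pM2r// ler_weXn2l// ler1n.
      by rewrite exprD -mulrA /r [leRHS]mulrCA ler_pM2l// exprn_gt0.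
    by have := dyadic_steps_ge Q U; rewrite -/NQ; lra.
  rewrite /F' kN' /F; set s := 2 ^+ (k + i0) * len Q.
  have s0 : 0 < s by rewrite mulr_gt0// exprn_gt0.
  have rs : r <= s by rewrite /s exprD -mulrA /r ler_pM2l// exprn_gt0.
  have sr : s <= 2 * r.
    by rewrite /s exprD -mulrA /r [leRHS]mulrCA ler_pM2l// exprn_gt0.
  rewrite SQ ler_pdivrMr ?powR_gt0//.
  apply: (le_trans (mbox_le_side hgrowth _ rs)).
  rewrite mulrAC -powRM// ?(ltW r0)// mulrC.
  rewrite -[leLHS](@divfK _ (s `^ n)) ?gt_eqF ?powR_gt0//.
  rewrite ler_wpM2l ?divr_ge0 ?mbox_ge0 ?powR_ge0//.
  by apply: ge0_ler_powR; rewrite ?nnegrE// ?mulr_ge0 ?(ltW s0) ?(ltW r0).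
have K1 := Kcoef_ge1 Q U.
have hsum : \sum_(1 <= k < N.+1)
    m (ctr S) (2 ^+ k * len S) / (2 ^+ k * len S) `^ n
    <= (A2 * 2 `^ n * 4 `^ e + A1) * G + 2 `^ n * (Kcoef mu n Q U - 1).
  apply: (le_trans (ler_sum_nat _)); first by move=> k /andP[]; exact: term.
  rewrite /= !big_split/= -!mulr_sumr [(_ + _) * G]mulrDl.
  apply: lerD; first apply: lerD.
  - by rewrite ler_wpM2l//; apply: hG => //; rewrite mulr_gt0.
  - by rewrite ler_wpM2l//; exact: hG.
  - rewrite ler_wpM2l ?powR_ge0// KcoefE [1 + _]addrC addrK.
    exact: shifted_sum_le.
rewrite KcoefE.
set X := (A2 * 2 `^ n * 4 `^ e + A1) * G in hsum *.
have X0 : 0 <= X by rewrite mulr_ge0// addr_ge0.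
have Y0 : 0 <= (2 : R) `^ n by exact: powR_ge0.
have : (1 + X) * 1 <= (1 + X) * Kcoef mu n Q U by rewrite ler_wpM2l//; lra.
by lra.
Qed.

End coefficients.

(** * Estimates normalised by the dilate *)

Section equivalence.
Context {R : realType} {d : nat}.
Variables (mu : {measure set (euclidean R d) -> \bar R}) (n C0 : R).
Hypothesis d_gt0 : (0 < d)%N.
Hypothesis n0 : 0 <= n.
Hypothesis nd : n <= d%:R.
Hypothesis C00 : 0 < C0.
Hypothesis hgrowth : growth mu n C0.
Variables (alpha eta : {posnum R}) (beta : R).
Hypothesis alpha1 : 1 < alpha%:num.
Hypothesis eta1 : 1 < eta%:num.
Hypothesis eta_alpha : eta%:num <= alpha%:num.
Hypothesis alpha_beta : alpha%:num ^+ d < beta.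
Implicit Types (Q S T P U : cube R d) (f : euclidean R d -> R).

Local Notation m := (mbox mu).
Local Notation al := (alpha%:num).
Local Notation et := (eta%:num).
Local Notation K := (Kcoef mu n).

Let beta1 : 1 < beta.
Proof. exact: beta_gt1 alpha1 alpha_beta. Qed.

Let beta_gt0 : 0 < beta.
Proof. exact: lt_trans ltr01 beta1. Qed.

Let mle x r s : r <= s -> m x r <= m x s.
Proof. exact: mbox_le_side hgrowth _ _ _. Qed.

Lemma nondoubling_chain Q j :
  (forall k, (k < j)%N ->
    ~ doubling mu alpha beta (dilate (al ^+ k)%:pos Q)) ->
  forall k, (k < j)%N ->
    beta * m (ctr Q) (al ^+ k * len Q) <= m (ctr Q) (al ^+ k.+1 * len Q).
Proof.
move=> h k kj; rewrite leNgt; apply/negP => hlt; apply: (h k kj).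
by apply/(doublingE hgrowth) => /=; rewrite mulrA -exprS ltW.
Qed.

Lemma doubling_eta_le Q : doubling mu alpha beta Q ->
  m (ctr Q) (et * len Q) <= beta * m (ctr Q) (len Q).
Proof.
move=> /(doublingE hgrowth); apply: le_trans; apply: mle.
by rewrite ler_pM2r.
Qed.

(** The estimates are normalised by the measure of the dilate by eta.  On a
    doubling cube this is comparable to the measure of the cube itself, because
    eta is at most alpha, so that they control means. *)
Lemma mean_doubling_le f Q c D : Lloc mu f -> doubling mu alpha beta Q ->
  0 < msr mu Q -> 0 <= D ->
  osc mu f (ctr Q) (len Q) c <= D * m (ctr Q) (et * len Q) ->
  `|mean mu Q f - c| <= D * beta.
Proof.
move=> hf dQ Q0 D0 h; apply: (le_trans (mean_sub_le hgrowth hf c Q0)).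
rewrite ler_pdivrMl// mulrC -mulrA; apply: (le_trans h).
by rewrite ler_wpM2l//; exact: doubling_eta_le.
Qed.

Lemma mbox_le_eta Q : m (ctr Q) (len Q) <= m (ctr Q) (et * len Q).
Proof. by apply: mle; rewrite ler_peMl// ltW. Qed.

(** Multiplying out the denominator also covers the cubes whose dilate is null,
    where the quotient is meaningless but both sides of the product vanish. *)
Lemma osc_eta_bound f Q c D : Lloc mu f ->
  (0 < msr mu (dilate eta Q) ->
    (msr mu (dilate eta Q))^-1 * \int[mu]_(y in cset Q) `|f y - c| <= D) ->
  osc mu f (ctr Q) (len Q) c <= D * m (ctr Q) (et * len Q).
Proof.
move=> hf h; have := mbox_ge0 mu (ctr Q) (et * len Q).
rewrite le_eqVlt => /predU1P[h0|h0]; last first.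
  by have := h h0; rewrite ler_pdivrMl// mulrC.
rewrite -h0 mulr0 (osc_null hgrowth)//; apply/eqP.
by rewrite eq_le mbox_ge0 andbT h0; exact: mbox_le_eta.
Qed.

Lemma osc_change_eta f Q c c' D D' : Lloc mu f ->
  osc mu f (ctr Q) (len Q) c <= D * m (ctr Q) (et * len Q) ->
  `|c - c'| <= D' ->
  osc mu f (ctr Q) (len Q) c' <= (D + D') * m (ctr Q) (et * len Q).
Proof.
move=> hf h h'; apply: (le_trans (osc_change hgrowth hf _ _ c' c)).
rewrite mulrDl; apply: lerD => //.
by apply: ler_pM; rewrite ?normr_ge0 ?mbox_ge0//; exact: mbox_le_eta.
Qed.

Lemma osc_eta_quotient f Q c D :
  osc mu f (ctr Q) (len Q) c <= D * m (ctr Q) (et * len Q) ->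
  0 < msr mu (dilate eta Q) ->
  (msr mu (dilate eta Q))^-1 * \int[mu]_(y in cset Q) `|f y - c| <= D.
Proof. by move=> h h0; rewrite ler_pdivrMl// mulrC. Qed.

Lemma osc_eta_quotient0 f Q D :
  osc mu f (ctr Q) (len Q) 0 <= D * m (ctr Q) (et * len Q) ->
  0 < msr mu (dilate eta Q) ->
  (msr mu (dilate eta Q))^-1 * \int[mu]_(y in cset Q) `|f y| <= D.
Proof.
move=> h h0; rewrite csetE osc0E ler_pdivrMl// mulrC; exact: h.
Qed.

(** * From the numbers attached to cubes to the means *)

Section cube_numbers.
Variables (e CK M C4 : R) (f : euclidean R d -> R) (fQ : cube R d -> R).
Hypothesis e0 : 0 < e.
Hypothesis ae : al `^ (n + e) = beta.
Hypothesis hf : Lloc mu f.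
Hypothesis hbd : rbmo2_bound mu n alpha eta beta f fQ C4.
Hypothesis CK0 : 0 <= CK.
Hypothesis hK : forall Q T (b : R), 0 < b -> len T <= al * b ->
  (forall r, len Q <= r ->
    m (ctr Q) r <= C0 * beta * (r `^ n * (r / b) `^ e)) ->
  K Q T <= CK.
Hypothesis M0 : 0 <= M.
Hypothesis hM : forall (A eta' : R), 0 <= A -> eta' <= et ->
  (forall z, osc mu f z 1 0 <= A * m z eta') ->
  forall x L, 1 <= L -> eta' - 1 <= (et - 1) * L ->
  osc mu f x L 0 <= M * A * m x (et * L).

Local Notation Y := (M * (2 + CK) * beta).

Let C4_ge0 : 0 <= C4.
Proof. by case: hbd. Qed.

Let Y_ge0 : 0 <= Y.
Proof. by rewrite !mulr_ge0// ?addr_ge0// ltW. Qed.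

Lemma number_osc_le Q : len Q <= 1 ->
  osc mu f (ctr Q) (len Q) (fQ Q) <= C4 * m (ctr Q) (et * len Q).
Proof.
by move=> Q1; have [_ ha _ _] := hbd; apply: osc_eta_bound => //; exact: ha.
Qed.

Lemma number_diff_le Q T : cset Q `<=` cset T -> len Q <= 1 ->
  cubesQex mu alpha beta T -> K Q T <= CK -> `|fQ Q - fQ T| <= CK * C4.
Proof.
move=> QT Q1 Tex KQT; have [_ _ hb _] := hbd.
apply: (le_trans (hb Q T QT Q1 Tex)).
by rewrite mulrC ler_wpM2r.
Qed.

(** A cube of side alpha that has a smaller doubling cube below it lies in
    Q_ex but not in Q, so its number is bounded by condition (c).  A small cube
    whose measure decays at a scale at least 1 has bounded coefficient with
    respect to such a cube. *)
Lemma number_le Q b : len Q <= 1 -> 1 <= b ->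
  (forall r, len Q <= r ->
    m (ctr Q) r <= C0 * beta * (r `^ n * (r / b) `^ e)) ->
  `|fQ Q| <= (1 + CK) * C4.
Proof.
move=> Q1 b1 hb; have [_ _ _ hc] := hbd.
have [T [T' [QT lT hT lT']]] := enclosing_cube_with_down C00 hgrowth
  alpha1 alpha_beta (le_lt_trans Q1 alpha1).
have T'1 : len T' <= 1 by move: lT'; rewrite divff.
have Tex : cubesQex mu alpha beta T by exists T'.
have Tn : ~ cubesQ T by rewrite /cubesQ /= lT; apply/negP; rewrite -ltNge.
have KQT : K Q T <= CK.
  by apply: (hK (b := b)) => //; [exact: lt_le_trans b1 | rewrite lT ler_peMr].
have h1 := hc T (conj Tex Tn).
have h2 := number_diff_le QT Q1 Tex KQT.
by have := ler_normD (fQ Q - fQ T) (fQ T); rewrite subrK; lra.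
Qed.

Lemma self_decay Q r : len Q <= r ->
  m (ctr Q) r <= C0 * beta * (r `^ n * (r / len Q) `^ e).
Proof.
have h : forall r, len Q <= r ->
    m (ctr Q) r <= C0 * beta * (r `^ n * (r / (al ^+ 0 * len Q)) `^ e).
  exact: decay_le.
by have := h r; rewrite expr0 mul1r.
Qed.

(** The numbers of unit cubes are bounded, so that condition (a) bounds the
    integral over unit cubes, hence over all larger cubes. *)
Lemma number_large_osc_le Q : 1 <= len Q ->
  osc mu f (ctr Q) (len Q) 0
    <= M * ((2 + CK) * C4) * m (ctr Q) (et * len Q).
Proof.
move=> Q1; apply: (hM (eta' := et)) => //.
- by rewrite mulr_ge0// addr_ge0.
- move=> z; pose S := Cube z (PosNum (@ltr01 R)).
  have S1 : len S <= 1 by [].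
  have := osc_change_eta (Q := S) (c := fQ S) (c' := 0) (D' := (1 + CK) * C4)
    hf (number_osc_le S1).
  rewrite subr0 => /(_ (number_le S1 (lexx 1) (@self_decay S))).
  by rewrite /= mulr1; congr (_ <= _ * _); ring.
- by rewrite ler_peMr// subr_ge0 ltW.
Qed.

Lemma number_mean_large S : 1 <= len S -> doubling mu alpha beta S ->
  0 < msr mu S -> `|mean mu S f| <= Y * C4.
Proof.
move=> S1 dS S0; have -> : Y * C4 = M * ((2 + CK) * C4) * beta by ring.
rewrite -[mean _ _ _]subr0; apply: mean_doubling_le => //.
  by rewrite !mulr_ge0// addr_ge0.
exact: number_large_osc_le.
Qed.

Lemma number_mean_small S : len S <= 1 -> doubling mu alpha beta S ->
  0 < msr mu S -> `|mean mu S f - fQ S| <= beta * C4.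
Proof.
move=> S1 dS S0; rewrite mulrC.
by apply: mean_doubling_le => //; exact: number_osc_le.
Qed.

(** Condition (b) only concerns pairs whose larger cube is in Q_ex, which the
    smallest doubling dilate S of Q need not be.  When S is small, the numbers
    of Q and of S are therefore compared through a third cube, slightly larger
    than S and in Q_ex; when S is large, both quantities are bounded. *)
Lemma number_mean_up Q S : len Q <= 1 -> is_up mu alpha beta Q S ->
  0 < msr mu S -> `|fQ Q - mean mu S f| <= (1 + 2 * CK + beta + Y) * C4.
Proof.
move=> Q1 [j [SE dS nd_k]] S0.
have hdec r : len Q <= r ->
    m (ctr Q) r <= C0 * beta * (r `^ n * (r / len S) `^ e).
  rewrite SE; apply: decay_le => //; exact: nondoubling_chain.
have bC : 0 <= beta * C4 by rewrite mulr_ge0// ltW.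
have KC : 0 <= CK * C4 by rewrite mulr_ge0.
have YC : 0 <= Y * C4 by rewrite mulr_ge0.
have C40 := C4_ge0.
have [S1|S1] := leP (len S) 1; last first.
  have h1 := number_le Q1 (ltW S1) hdec.
  have h2 := number_mean_large (ltW S1) dS S0.
  by have := ler_normB (fQ Q) (mean mu S f); lra.
have lS : len S < (al * len S)%:pos%:num by rewrite /= ltr_pMl.
have [T [T' [ST lT hT lT']]] := enclosing_cube_with_down C00 hgrowth
  alpha1 alpha_beta lS.
rewrite /= in lT.
have T'1 : len T' <= 1.
  by apply: (le_trans lT'); rewrite /= mulrAC divff// mul1r.
have Tex : cubesQex mu alpha beta T by exists T'.
have QS : cset Q `<=` cset S.
  rewrite SE; apply: box_sub => i /=; rewrite subrr normr0.
  by rewrite divr_ge0// subr_ge0 ler_peMl// exprn_ege1// ltW.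
have KQT : K Q T <= CK by apply: (hK (b := len S)) => //; rewrite lT.
have KST : K S T <= CK.
  by apply: (hK (b := len S)) => //; [rewrite lT | exact: self_decay].
have h1 := number_diff_le (subset_trans QS ST) Q1 Tex KQT.
have h2 := number_diff_le ST S1 Tex KST.
have h3 := number_mean_small S1 dS S0.
have := ler_distD (fQ T) (fQ Q) (mean mu S f).
have := ler_distD (fQ S) (fQ T) (mean mu S f).
by rewrite (distrC (fQ T) (fQ S)) (distrC (fQ S) (mean _ _ _)); lra.
Qed.

Lemma number_mean_ex S : cubesQex mu alpha beta S -> doubling mu alpha beta S ->
  0 < msr mu S -> `|fQ S - mean mu S f| <= (1 + beta + Y) * C4.
Proof.
move=> Sex dS S0; have C40 := C4_ge0.
have bC : 0 <= beta * C4 by rewrite mulr_ge0// ltW.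
have YC : 0 <= Y * C4 by rewrite mulr_ge0.
have [S1|S1] := leP (len S) 1.
  by have := number_mean_small S1 dS S0; rewrite distrC; lra.
have Sn : ~ cubesQ S by apply/negP; rewrite -ltNge.
have [_ _ _ hc] := hbd; have h := hc S (conj Sex Sn).
have h2 := number_mean_large (ltW S1) dS S0.
by have := ler_normB (fQ S) (mean mu S f); lra.
Qed.

Lemma number_mean_diff Q S : doubling mu alpha beta Q ->
  doubling mu alpha beta S -> cset Q `<=` cset S -> len Q <= 1 ->
  cubesQex mu alpha beta S -> 0 < msr mu Q -> 0 < msr mu S ->
  `|mean mu Q f - mean mu S f| <= (2 + 2 * beta + Y) * C4 * K Q S.
Proof.
move=> dQ dS QS Q1 Sex Q0 S0; have [_ _ hb _] := hbd.
have h1 := number_mean_small Q1 dQ Q0.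
have h2 := hb Q S QS Q1 Sex.
have h3 := number_mean_ex Sex dS S0.
have K1 : 1 <= K Q S by exact: Kcoef_ge1.
have h4 : (1 + 2 * beta + Y) * C4 <= (1 + 2 * beta + Y) * C4 * K Q S.
  by rewrite ler_peMr// mulr_ge0// !addr_ge0// mulr_ge0// ltW.
have := ler_distD (fQ Q) (mean mu Q f) (mean mu S f).
have := ler_distD (fQ S) (fQ Q) (mean mu S f).
by lra.
Qed.

End cube_numbers.

Lemma rbmo1_of_rbmo2 : exists2 C : R, 1 <= C & forall f fQ C4, Lloc mu f ->
  rbmo2_bound mu n alpha eta beta f fQ C4 ->
  rbmo1_bound mu n alpha eta beta f (C * C4).
Proof.
have [e e0 ae] := decay_exponent_ex nd alpha1 alpha_beta.
have bge1 := beta1.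
have A0 : 0 <= C0 * beta by rewrite mulr_ge0// ltW.
have al0 : 0 < al by [].
have [CK CK0 hK] := Kcoef_bounded mu n e0 A0 al0.
have [M M0 hM] := large_cube_osc_le hgrowth (ltW (lt_trans ltr01 eta1)).
set Y := M * (2 + CK) * beta.
have Y0 : 0 <= Y by rewrite !mulr_ge0//; lra.
exists (2 + 2 * CK + 2 * beta + Y); first by lra.
move=> f fQ C4 hf hbd; have [C40 _ _ _] := hbd.
have hMf A eta' := hM f A et eta' hf.
have bC : 0 <= beta * C4 by rewrite mulr_ge0//; lra.
have KC : 0 <= CK * C4 by rewrite mulr_ge0.
have YC : 0 <= Y * C4 by rewrite mulr_ge0.
split.
- by rewrite mulr_ge0//; lra.
- move=> Q S Q1 QS Qe0 S0; apply: osc_eta_quotient => //.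
  have h := number_mean_up e0 ae hf hbd CK0 hK M0 hMf Q1 QS S0.
  apply: (le_trans (osc_change_eta hf (number_osc_le hf hbd Q1) h)).
  by rewrite ler_wpM2r ?mbox_ge0// -/Y; lra.
- move=> Q S dQ dS QS Q1 Sex Q0 S0.
  have h := number_mean_diff e0 ae hf hbd CK0 hK M0 hMf dQ dS QS Q1 Sex Q0 S0.
  apply: (le_trans h); rewrite ler_wpM2r//.
    exact: le_trans ler01 (Kcoef_ge1 _ _ _ _).
  by rewrite -/Y; lra.
- move=> Q [Qex Qn] Qe0; apply: osc_eta_quotient0 => //.
  have Q1 : 1 <= len Q.
    by rewrite leNgt; apply/negP => h; apply: Qn; exact: ltW.
  apply: (le_trans (number_large_osc_le e0 ae hf hbd CK0 hK hMf Q1)).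
  have hY : M * ((2 + CK) * C4) <= Y * C4.
    have -> : Y * C4 = M * ((2 + CK) * C4) * beta by rewrite /Y; ring.
    by rewrite ler_peMr ?(ltW beta1)// !mulr_ge0// addr_ge0.
  by rewrite ler_wpM2r ?mbox_ge0//; lra.
Qed.

(** * From the means to the numbers attached to cubes *)

(** As the cube Q with a tilde, but of positive measure, so that the mean over
    it makes sense even if Q and some of its dilates are null. *)
Definition is_hat Q S : Prop :=
  exists j, [/\ S = dilate (al ^+ j)%:pos Q, doubling mu alpha beta S,
    0 < msr mu S & forall k, (k < j)%N ->
      ~ (doubling mu alpha beta (dilate (al ^+ k)%:pos Q) /\
         0 < msr mu (dilate (al ^+ k)%:pos Q))].

Lemma hat_chain Q j :
  (forall k, (k < j)%N ->
    ~ (doubling mu alpha beta (dilate (al ^+ k)%:pos Q) /\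
       0 < msr mu (dilate (al ^+ k)%:pos Q))) ->
  forall k, (k < j)%N ->
    beta * m (ctr Q) (al ^+ k * len Q) <= m (ctr Q) (al ^+ k.+1 * len Q).
Proof.
move=> h k kj; have := mbox_ge0 mu (ctr Q) (al ^+ k * len Q).
rewrite le_eqVlt => /predU1P[<-|h0]; first by rewrite mulr0 mbox_ge0.
rewrite leNgt; apply/negP => hlt; apply: (h k kj); split => //.
by apply/(doublingE hgrowth) => /=; rewrite mulrA -exprS ltW.
Qed.

Lemma hat_ex Q i : 0 < m (ctr Q) (al ^+ i * len Q) -> exists S, is_hat Q S.
Proof.
move=> h.
have [k0 [pk dk]] :=
  positive_doubling_ex nd hgrowth alpha1 alpha_beta (gt0 _) h.
have ex : exists k, `[< doubling mu alpha beta (dilate (al ^+ k)%:pos Q) /\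
         0 < msr mu (dilate (al ^+ k)%:pos Q) >].
  exists k0; apply/asboolP; split => //; apply/(doublingE hgrowth) => /=.
  by rewrite mulrA -exprS.
case: (ex_minnP ex) => j /asboolP[dj pj] jmin.
exists (dilate (al ^+ j)%:pos Q), j; split => // k kj hk.
have := jmin k; rewrite leqNgt kj => hjk.
suff : false by [].
by apply: hjk; apply/asboolP.
Qed.

Lemma hat_unique Q S S' : is_hat Q S -> is_hat Q S' -> S = S'.
Proof.
move=> [j [-> dS pS hj]] [j' [-> dS' pS' hj']].
by have [jj'|jj'|->//] := ltngtP j j'; [case: (hj' _ jj') | case: (hj _ jj')].
Qed.

Lemma hat_sub Q S : is_hat Q S -> cset Q `<=` cset S.
Proof.
move=> [j [-> _ _ _]]; apply: box_sub => i /=; rewrite subrr normr0.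
by rewrite divr_ge0// subr_ge0 ler_peMl// exprn_ege1// ltW.
Qed.

Lemma hat_len Q S : is_hat Q S -> len Q <= len S.
Proof. by move=> [j [-> _ _ _]] /=; rewrite ler_peMl// exprn_ege1// ltW. Qed.

Lemma hat_ctr Q S : is_hat Q S -> ctr S = ctr Q.
Proof. by move=> [j [-> _ _ _]]. Qed.

Lemma hat_decay (e : R) Q S : 0 < e -> al `^ (n + e) = beta -> is_hat Q S ->
  forall r : R, len Q <= r ->
    m (ctr Q) r <= C0 * beta * (r `^ n * (r / len S) `^ e).
Proof.
by move=> e0 ae [j [-> _ _ hj]] r; apply: decay_le => //; exact: hat_chain.
Qed.

(** Some large dilate of U contains a cube of positive measure. *)
Lemma hat_transfer Q S U : is_hat Q S -> exists W, is_hat U W.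
Proof.
move=> [j [_ _ S0 _]].
pose D := \sum_(i : 'I_d) `|ctr S ord0 i - ctr U ord0 i|.
have [N /(_ N (leqnn N))] := expr_unbounded ((2 * D + len S) / len U) alpha1.
rewrite ltr_pdivrMr// => hN; apply: (@hat_ex U N); apply: (lt_le_trans S0).
apply: (mbox_le hgrowth) => i.
have : `|ctr S ord0 i - ctr U ord0 i| <= D.
  by rewrite /D (bigD1 i)//= lerDl sumr_ge0.
by lra.
Qed.

Lemma hat_exists_eta Q : 0 < msr mu (dilate eta Q) -> exists S, is_hat Q S.
Proof.
move=> h; apply: (@hat_ex Q 1); apply: (lt_le_trans h).
by rewrite expr1; apply: mle => /=; rewrite ler_pM2r.
Qed.

Lemma hat_is_up Q S : 0 < msr mu (dilate eta Q) -> is_hat Q S ->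
  is_up mu alpha beta Q S.
Proof.
move=> Qe0 [j [SE dS pS hj]]; exists j; split => // k kj dk.
apply: (hj k kj); split => //.
have b0 : 0 < beta by have b1 := beta1; lra.
rewrite -(pmulr_rgt0 _ b0); apply: (lt_le_trans Qe0).
apply: le_trans ((doublingE hgrowth _ _ _).1 dk) => /=.
apply: mle; rewrite mulrA ler_pM2r//; apply: (le_trans eta_alpha).
by rewrite ler_peMr// exprn_ege1// ltW.
Qed.

(** T is the hat of P: since P has positive measure, the dilates of P smaller
    than T are not doubling, so that the largest doubling cube below T is the
    one below P. *)
Lemma doubling_cube_above (e : R) P P' : 0 < e -> al `^ (n + e) = beta ->
  0 < msr mu P -> is_down mu alpha beta P P' -> len P' <= 1 ->
  exists T, [/\ doubling mu alpha beta T, 0 < msr mu T, cset P `<=` cset T,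
    len P <= len T & cubesQex mu alpha beta T] /\
    forall r : R, len P <= r ->
      m (ctr P) r <= C0 * beta * (r `^ n * (r / len T) `^ e).
Proof.
move=> e0 ae P0 [N [N0 P'E dP' hN]] P'1.
have [T hT] : exists T, is_hat P T.
  by apply: (@hat_ex P 0); rewrite expr0 mul1r.
exists T; split; last exact: hat_decay.
have PT := hat_sub hT; have lPT := hat_len hT.
case: hT => j [TE dT pT hj]; split => //.
exists P' => //; exists (N + j)%N; split => //; first by rewrite addn_gt0 N0.
  rewrite P'E TE; apply: cube_eq => //=.
  by rewrite exprD invfM -mulrA mulKf// expf_neq0// gt_eqF.
move=> k /andP[k0 kN].
have [kj|jk] := leqP k j.
  have -> : dilate (al ^- k)%:pos T = dilate (al ^+ (j - k))%:pos P.
    rewrite TE; apply: cube_eq => //=.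
      have -> : al ^+ j = al ^+ (j - k) * al ^+ k by rewrite -exprD subnK.
    by rewrite -(mulrA _ (al ^+ k)) mulrCA mulKf.
  move=> hd; apply: (hj (j - k)%N).
    by rewrite ltn_subrL k0 (leq_trans k0 kj).
  split => //; apply: (lt_le_trans P0); apply: mle => /=.
  by rewrite ler_peMl// exprn_ege1// ltW.
have -> : dilate (al ^- k)%:pos T = dilate (al ^- (k - j))%:pos P.
  rewrite TE; apply: cube_eq => //=.
  have -> : al ^+ k = al ^+ (k - j) * al ^+ j by rewrite -exprD subnK// ltnW.
  by rewrite invfM -mulrA mulKf.
apply: hN; apply/andP; split; first by rewrite subn_gt0.
by rewrite -(ltn_add2r j) subnK// ltnW.
Qed.

Definition hat_value f Q : R :=
  if pselect (exists S, is_hat Q S /\ len S <= 1) is left h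
  then mean mu (projT1 (cid h)) f else 0.

Lemma hat_value_mean f Q S : is_hat Q S -> len S <= 1 ->
  hat_value f Q = mean mu S f.
Proof.
move=> hS S1; rewrite /hat_value; case: pselect => [h|]; last first.
  by case; exists S.
by case: cid => /= W [hW _]; rewrite (hat_unique hW hS).
Qed.

Lemma hat_value_0 f Q : (forall S, is_hat Q S -> 1 < len S) ->
  hat_value f Q = 0.
Proof.
move=> h; rewrite /hat_value; case: pselect => // -[S [hS S1]].
by exfalso; have := h S hS; rewrite ltNge S1.
Qed.

(** A unit cube lies in a cube T of side 1 + s that belongs to Q_ex but not to
    Q, where condition (c) applies.  The dilate of T by eta is contained in the
    dilate of the unit cube by et * (1 + s) + s, which must stay in the dilate
    by eta of the large cube: q is the largest s for which it does. *)
Lemma rbmo1_large_cube : exists2 M : R, 0 <= M & forall f C3, Lloc mu f ->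
  rbmo1_bound mu n alpha eta beta f C3 ->
  forall Q, 1 < len Q ->
    osc mu f (ctr Q) (len Q) 0 <= M * C3 * m (ctr Q) (et * len Q).
Proof.
have a1 := alpha1; have e1 := eta1.
have H0 : 0 <= et * al + al by rewrite addr_ge0// mulr_ge0.
have [M M0 hM] := large_cube_osc_le hgrowth H0.
exists M => // f C3 hf [C30 ha hb hc] Q Q1.
have den0 : 0 < et + 1 by lra.
pose q := (et - 1) * (len Q - 1) / (et + 1).
have q0 : 0 < q by rewrite divr_gt0// mulr_gt0//; lra.
have qE : q * (et + 1) = (et - 1) * (len Q - 1) by rewrite divfK// gt_eqF.
pose s := Num.min (al - 1) q.
have s0 : 0 < s by rewrite lt_min q0 subr_gt0 a1.
have sal : s <= al - 1 by rewrite ge_min lexx.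
have sq : s <= q by rewrite ge_min lexx orbT.
have t0 : 0 < 1 + s by lra.
pose t := PosNum t0.
apply: (hM f C3 et (et * (1 + s) + s)) => //; last 2 first.
- exact: ltW.
- have : s * (et + 1) <= q * (et + 1) by rewrite ler_pM2r.
  by lra.
- have : et * (1 + s) <= et * al by rewrite ler_pM2l//; lra.
  by lra.
move=> z; pose S := Cube z (PosNum (@ltr01 R)).
have St : len S < t%:num by rewrite /=; lra.
have [T [T' [ST lT hT lT']]] := enclosing_cube_with_down C00 hgrowth
  alpha1 alpha_beta St.
rewrite /= in lT lT'.
have T'1 : len T' <= 1.
  by apply: (le_trans lT'); rewrite ler_pdivrMr// mul1r; lra.
have Tex : cubesQex mu alpha beta T by exists T'.
have Tn : ~ cubesQ T by rewrite /cubesQ /= lT; apply/negP; rewrite -ltNge; lra.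
apply: (le_trans (osc_subset hgrowth hf 0 ST)).
have hT0 : osc mu f (ctr T) (len T) 0 <= C3 * m (ctr T) (et * len T).
  apply: osc_eta_bound => // h; have := hc T (conj Tex Tn) h.
  by rewrite csetE osc0E.
apply: (le_trans hT0); rewrite ler_wpM2l// lT; apply: (mbox_le hgrowth) => i.
have := sub_box ler01 ST i; rewrite lT /= distrC.
by lra.
Qed.

Section hat_values.
Variables (e M CM C3 : R) (f : euclidean R d -> R).
Hypothesis e0 : 0 < e.
Hypothesis ae : al `^ (n + e) = beta.
Hypothesis hf : Lloc mu f.
Hypothesis hbd : rbmo1_bound mu n alpha eta beta f C3.
Hypothesis M0 : 0 <= M.
Hypothesis hM : forall Q, 1 < len Q ->
  osc mu f (ctr Q) (len Q) 0 <= M * C3 * m (ctr Q) (et * len Q).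
Hypothesis CM0 : 0 <= CM.

(** The first summand serves when both cubes of a pair are small, the second one
    when the larger of them has side greater than 1. *)
Definition hat_decay_const : R :=
  C0 * beta * 2 `^ n * 2 `^ e * (4 * al) `^ e + C0 * al `^ e.

Local Notation A1 := hat_decay_const.
Local Notation A2 := (C0 * beta).

Hypothesis hCM : forall Q U S P T,
    ctr S = ctr Q -> len Q <= len S -> cset S `<=` cset P ->
    (forall r, len U <= r -> r < len P ->
       m (ctr Q) r <= A1 * (r `^ n * (r / len P) `^ e)) ->
    (forall r, len P <= r -> m (ctr P) r <= A2 * (r `^ n * (r / len T) `^ e)) ->
    K S T <= CM * K Q U.

Lemma C3_ge0 : 0 <= C3.
Proof. by case: hbd. Qed.

Lemma hat_value_const_ge0 : 0 <= (CM + M * beta) * C3.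
Proof.
rewrite mulr_ge0 ?C3_ge0 ?addr_ge0 ?mulr_ge0// ltW//.
Qed.

Lemma decay_const_ge0 : 0 <= C0 * beta * 2 `^ n * 2 `^ e * (4 * al) `^ e.
Proof.
rewrite !mulr_ge0 ?powR_ge0// ltW//.
Qed.

Lemma unit_scale_decay x r : 1 < r ->
  m x r <= A1 * (r `^ n * (r / al) `^ e).
Proof.
move=> r1; have r0 : 0 < r by exact: lt_trans ltr01 r1.
apply: (le_trans (mbox_growth hgrowth _ r0)).
apply: (@le_trans _ _ (C0 * al `^ e * (r `^ n * (r / al) `^ e))).
  rewrite -mulrA ler_pM2l// mulrCA -powRM ?divr_ge0 ?(ltW r0)//.
  rewrite [al * _]mulrC divfK// ler_peMr ?powR_ge0//.
  rewrite -[leLHS](_ : (1 : R) `^ e = 1); last by rewrite powR1.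
  by apply: ge0_ler_powR; rewrite ?nnegrE ?ler01// ltW.
by rewrite ler_wpM2r ?mulr_ge0 ?powR_ge0// lerDr decay_const_ge0.
Qed.

(** The density around either centre decays at the scale of the larger hat:
    cubes of side r >= l(U) centred at the one are contained in cubes of side 2r
    centred at the other. *)
Lemma two_hats_decay Q U S W (x : 'rV[R]_d) (b r : R) :
  is_hat Q S -> is_hat U W -> len Q <= len U ->
  (forall i, `|x ord0 i - ctr Q ord0 i| <= len U / 2) ->
  (forall i, `|x ord0 i - ctr U ord0 i| <= len U / 2) ->
  0 < b -> b <= 4 * al * Num.max (len S) (len W) -> len U <= r ->
  m x r <= A1 * (r `^ n * (r / b) `^ e).
Proof.
move=> hS hW QU xQ xU bpos; set mx := Num.max _ _ => bmx Ur.
have U0 : 0 < len U by [].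
have r0 : 0 < r by exact: lt_le_trans Ur.
have mx0 : 0 < mx by rewrite lt_max; apply/orP; left.
have h : m x r <= C0 * beta * ((2 * r) `^ n * (2 * r / mx) `^ e).
  have [SW|WS] := leP (len S) (len W).
    have -> : mx = len W by apply/max_idPr.
    apply: le_trans (hat_decay e0 ae hW _); last by lra.
    by apply: (mbox_le hgrowth) => i; apply: (le_trans (xU i)); lra.
  have -> : mx = len S by apply/max_idPl/ltW.
  apply: le_trans (hat_decay e0 ae hS _); last by lra.
  by apply: (mbox_le hgrowth) => i; apply: (le_trans (xQ i)); lra.
apply: (le_trans h).
apply: (@le_trans _ _ (C0 * beta * 2 `^ n * 2 `^ e * (4 * al) `^ e *
    (r `^ n * (r / b) `^ e))); last first.
  rewrite ler_wpM2r ?mulr_ge0 ?powR_ge0// lerDl.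
  by rewrite mulr_ge0 ?powR_ge0// ltW.
have h2 : (2 * r / mx) `^ e <= 2 `^ e * ((4 * al) `^ e * (r / b) `^ e).
  rewrite -!powRM ?mulr_ge0 ?divr_ge0 ?invr_ge0 ?(ltW r0) ?(ltW bpos)//.
  apply: ge0_ler_powR; first exact: ltW.
  - by rewrite nnegrE divr_ge0 ?mulr_ge0 ?(ltW r0) ?(ltW mx0).
  - by rewrite nnegrE !mulr_ge0 ?invr_ge0 ?(ltW r0) ?(ltW bpos).
  rewrite ler_pdivrMr// -mulrA ler_pM2l// mulrAC mulrA ler_pdivlMr//.
  by rewrite mulrC ler_pM2r.
rewrite powRM ?(ltW r0)//.
have -> : C0 * beta * 2 `^ n * 2 `^ e * (4 * al) `^ e *
    (r `^ n * (r / b) `^ e) = C0 * beta * (2 `^ n * r `^ n *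
    (2 `^ e * ((4 * al) `^ e * (r / b) `^ e))) by ring.
have A20 : 0 <= C0 * beta by rewrite mulr_ge0// ltW//.
by rewrite ler_wpM2l// ler_wpM2l// mulr_ge0 ?powR_ge0.
Qed.

Lemma mean_large_le S : 1 < len S -> doubling mu alpha beta S ->
  0 < msr mu S -> `|mean mu S f| <= M * beta * C3.
Proof.
move=> S1 dS S0; rewrite mulrAC -[mean _ _ _]subr0.
apply: mean_doubling_le => //; last exact: hM.
by rewrite mulr_ge0 ?C3_ge0.
Qed.

(** T depends on P only, so that it serves for all the hats contained in P. *)
Lemma doubling_above P P' : is_down mu alpha beta P P' -> len P' <= 1 ->
  0 < msr mu P ->
  exists T, [/\ doubling mu alpha beta T, 0 < msr mu T, len P <= len T &
    forall Q U S, is_hat Q S -> cset S `<=` cset P -> len S <= 1 ->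
    (forall r : R, len U <= r -> r < len P ->
      m (ctr Q) r <= A1 * (r `^ n * (r / len P) `^ e)) ->
    `|mean mu S f - mean mu T f| <= CM * C3 * K Q U].
Proof.
move=> hP P'1 P0.
have [T [[dT T0 PT lPT Tex] h2]] := doubling_cube_above e0 ae P0 hP P'1.
exists T; split => // Q U S hS SP S1 h1.
have [j [_ dS S0 _]] := hS; have [_ _ hb _] := hbd.
apply: (le_trans (hb S T dS dT (subset_trans SP PT) S1 Tex S0 T0)).
rewrite mulrAC [leRHS]mulrC ler_wpM2l ?C3_ge0//.
exact: (hCM (hat_ctr hS) (hat_len hS) SP h1 h2).
Qed.

(** The mean over the hat is compared with the mean over a doubling cube of side
    at least alpha, which is bounded. *)
Lemma hat_value_bound Q U S : is_hat Q S ->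
  (forall r : R, len U <= r -> r < al ->
     m (ctr Q) r <= A1 * (r `^ n * (r / al) `^ e)) ->
  `|hat_value f Q| <= (CM + M * beta) * C3 * K Q U.
Proof.
move=> hS h1; have K1 : 1 <= K Q U by exact: Kcoef_ge1.
have [S1|S1] := leP (len S) 1; last first.
  rewrite hat_value_0; last by move=> W hW; rewrite (hat_unique hW hS).
  by rewrite normr0 mulr_ge0 ?hat_value_const_ge0// (le_trans ler01 K1).
rewrite (hat_value_mean f hS S1).
have [P [P' [SP lP hP lP']]] := enclosing_cube_with_down C00 hgrowth
  alpha1 alpha_beta (le_lt_trans S1 alpha1).
have P'1 : len P' <= 1 by move: lP'; rewrite divff.
have P0 : 0 < msr mu P.
  have [j [_ _ S0 _]] := hS; apply: (lt_le_trans S0).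
  exact: (mbox_subset hgrowth).
have [T [dT T0 lPT hT]] := doubling_above hP P'1 P0.
have {}hT : `|mean mu S f - mean mu T f| <= CM * C3 * K Q U.
  by apply: hT => //; rewrite lP.
have T1 : 1 < len T by rewrite (lt_le_trans _ lPT)// lP.
have h4 := mean_large_le T1 dT T0.
have B0 : 0 <= M * beta * C3 by exact: le_trans h4.
have := ler_normD (mean mu S f - mean mu T f) (mean mu T f).
rewrite subrK => /le_trans; apply; rewrite mulrDl mulrDl; apply: lerD => //.
by apply: (le_trans h4); rewrite ler_peMr.
Qed.

Lemma hat_value_large Q : 1 < len Q -> hat_value f Q = 0.
Proof. by move=> Q1; apply: hat_value_0 => S /hat_len; exact: lt_le_trans. Qed.

Lemma hat_value_osc Q : len Q <= 1 -> 0 < msr mu (dilate eta Q) ->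
  osc mu f (ctr Q) (len Q) (hat_value f Q)
    <= (C3 + M * beta * C3) * m (ctr Q) (et * len Q).
Proof.
move=> Q1 Qe0; have [S hS] := hat_exists_eta Qe0.
have [j [SE dS S0 _]] := hS; have [_ ha _ _] := hbd.
have h : osc mu f (ctr Q) (len Q) (mean mu S f)
    <= C3 * m (ctr Q) (et * len Q).
  by apply: osc_eta_bound => // h; apply: ha => //; exact: hat_is_up.
have [S1|S1] := leP (len S) 1.
  rewrite (hat_value_mean f hS S1); apply: (le_trans h).
  by rewrite ler_wpM2r ?mbox_ge0// lerDl !mulr_ge0 ?C3_ge0// ltW.
rewrite hat_value_0; last by move=> W hW; rewrite (hat_unique hW hS).
apply: osc_change_eta h _ => //.
by rewrite subr0; exact: mean_large_le.
Qed.

(** If the larger of the two hats has side at least 1/4, both values are bounded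
    by a multiple of K separately.  Otherwise a cube P that contains both hats
    can be chosen of side less than 1, four times that of the larger hat, and
    the two means are compared with the mean over one doubling cube above P. *)
Lemma hat_value_chain Q U : cset Q `<=` cset U -> len Q <= 1 ->
  `|hat_value f Q - hat_value f U|
    <= 2 * ((CM + M * beta) * C3) * K Q U.
Proof.
move=> QU Q1; set B := (CM + M * beta) * C3.
have B0 : 0 <= B by exact: hat_value_const_ge0.
have K1 : 1 <= K Q U by exact: Kcoef_ge1.
have BK : B <= B * K Q U by rewrite ler_peMr.
have BK0 : 0 <= B * K Q U by exact: le_trans BK.
have [[S hS]|noS] := pselect (exists S, is_hat Q S); last first.
  have noU W : ~ is_hat U W.
    by move=> /(hat_transfer Q)[S hS]; apply: noS; exists S.
  rewrite !hat_value_0 ?subrr ?normr0; first by lra.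
    by move=> W /noU.
  by move=> W hW; exfalso; apply: noS; exists W.
have [W hW] := hat_transfer U hS.
have Q0 : 0 < len Q by [].
have QUi := sub_box (ltW Q0) QU.
have QUlen : len Q <= len U.
  by have := le_trans (normr_ge0 _) (QUi (Ordinal d_gt0)); lra.
have [U1|U1] := leP (len U) 1; last first.
  rewrite (hat_value_large U1) subr0.
  have h : `|hat_value f Q| <= B * K Q U.
    apply: (hat_value_bound hS) => r Ur _.
    by apply: unit_scale_decay; exact: lt_le_trans Ur.
  by lra.
set mx := Num.max (len S) (len W).
have mxS : len S <= mx by rewrite le_max lexx.
have mxW : len W <= mx by rewrite le_max lexx orbT.
have mx0 : 0 < mx by apply: lt_le_trans mxS.
have QQ i : `|ctr Q ord0 i - ctr Q ord0 i| <= len U / 2.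
  by rewrite subrr normr0 divr_ge0.
have UU i : `|ctr U ord0 i - ctr U ord0 i| <= len U / 2.
  by rewrite subrr normr0 divr_ge0.
have QUi' i : `|ctr Q ord0 i - ctr U ord0 i| <= len U / 2.
  by apply: (le_trans (QUi i)); rewrite ler_pM2r// gerBl.
have UQi i : `|ctr U ord0 i - ctr Q ord0 i| <= len U / 2 by rewrite distrC.
have dQ b r := two_hats_decay (b := b) (r := r) hS hW QUlen QQ QUi'.
have dU b r := two_hats_decay (b := b) (r := r) hS hW QUlen UQi UU.
have KUU : K U U = 1 by exact: Kcoef_id.
have [big|small] := leP 1 (4 * mx).
  have almx : al <= 4 * al * mx by rewrite mulrAC ler_peMl.
  have h1 : `|hat_value f Q| <= B * K Q U.
    by apply: (hat_value_bound hS) => r Ur _; exact: dQ.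
  have h2 : `|hat_value f U| <= B * K U U.
    by apply: (hat_value_bound hW) => r Ur _; exact: dU.
  rewrite KUU mulr1 in h2.
  apply: (le_trans (ler_normB _ _)); apply: (le_trans (lerD h1 h2)).
  by rewrite -mulrA [leRHS]mulr_natl mulr2n lerD2l.
have S1 : len S <= 1 by lra.
have W1 : len W <= 1 by lra.
rewrite (hat_value_mean f hS S1) (hat_value_mean f hW W1).
have p0 : 0 < len W + 2 * len S by rewrite addr_gt0// mulr_gt0.
(* centred like W, with room for S on both sides *)
pose P0 := Cube (ctr U) (PosNum p0).
have mx40 : 0 < 4 * mx by rewrite mulr_gt0.
have P0lt : len P0 < (PosNum mx40)%:num by rewrite /=; lra.
have [P [P' [PP lP hP lP']]] := enclosing_cube_with_down C00 hgrowth
  alpha1 alpha_beta P0lt.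
rewrite /= in lP lP'.
have P'1 : len P' <= 1.
  apply: (le_trans lP'); rewrite ler_pdivrMr// mul1r ltW//.
  exact: lt_trans small alpha1.
have UW : len U <= len W by exact: hat_len.
have SP : cset S `<=` cset P.
  apply: subset_trans PP; apply: box_sub => i /=.
  rewrite (hat_ctr hS); apply: (le_trans (QUi' i)).
  by have : 0 < len S by []; lra.
have WP : cset W `<=` cset P.
  apply: subset_trans PP; apply: box_sub => i /=.
  by rewrite (hat_ctr hW) subrr normr0; have : 0 < len S by []; lra.
have P_gt0 : 0 < msr mu P.
  have [j [_ _ S0 _]] := hS; apply: (lt_le_trans S0).
  exact: (mbox_subset hgrowth).
have [T [dT T0 lPT hT]] := doubling_above hP P'1 P_gt0.
have lP4 : len P <= 4 * al * mx.
  by rewrite lP ler_pM2r// ler_peMr// ltW.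
have h3 : `|mean mu S f - mean mu T f| <= CM * C3 * K Q U.
  by apply: hT => // r Ur _; exact: dQ.
have h4 : `|mean mu W f - mean mu T f| <= CM * C3 * K U U.
  by apply: hT => // r Ur _; exact: dU.
have CB : CM * C3 <= B.
  by rewrite /B mulrDl lerDl !mulr_ge0 ?C3_ge0// ltW.
rewrite KUU mulr1 in h4.
apply: (le_trans (ler_distD (mean mu T f) _ _)); rewrite (distrC (mean mu T f)).
apply: (le_trans (lerD h3 h4)); rewrite -[leRHS]mulrA [leRHS]mulr_natl mulr2n.
apply: lerD; last exact: le_trans CB BK.
by rewrite ler_wpM2r// (le_trans ler01 K1).
Qed.

End hat_values.

Lemma rbmo2_of_rbmo1 : exists2 C : R, 1 <= C & forall f C3, Lloc mu f ->
  rbmo1_bound mu n alpha eta beta f C3 ->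
  rbmo2_bound mu n alpha eta beta f (hat_value f) (C * C3).
Proof.
have [e e0 ae] := decay_exponent_ex nd alpha1 alpha_beta.
have [M M0 hM] := rbmo1_large_cube.
have beta0 := beta_gt0; have c0 := C00.
have A20 : 0 <= C0 * beta by rewrite mulr_ge0 ?ltW.
have A10 : 0 <= hat_decay_const e.
  by rewrite addr_ge0// !mulr_ge0 ?powR_ge0 ?ltW.
have [CM CM0 hCM] := Kcoef_compare n0 hgrowth e0 A10 A20.
have Mb0 : 0 <= M * beta by rewrite mulr_ge0// ltW.
exists (1 + 2 * (CM + M * beta)); first by lra.
move=> f C3 hf hbd; have [C30 _ _ _] := hbd.
have hMf Q := hM f C3 hf hbd Q.
have CMC0 : 0 <= CM * C3 by rewrite mulr_ge0.
have MC0 : 0 <= M * beta * C3 by rewrite mulr_ge0.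
have Csplit : (1 + 2 * (CM + M * beta)) * C3 =
  C3 + 2 * ((CM + M * beta) * C3) by ring.
split.
- by rewrite mulr_ge0//; lra.
- move=> Q Q1 Qe0; apply: osc_eta_quotient => //.
  apply: (le_trans (hat_value_osc hf hbd M0 hMf Q1 Qe0)).
  by rewrite ler_wpM2r ?mbox_ge0//; lra.
- move=> Q U QU Q1 _.
  apply: (le_trans (hat_value_chain e0 ae hf hbd M0 hMf CM0 hCM QU Q1)).
  rewrite ler_wpM2r ?Csplit ?lerDr//.
  exact: le_trans ler01 (Kcoef_ge1 _ _ _ _).
- move=> Q [_ Q1]; rewrite hat_value_large ?normr0.
    by rewrite mulr_ge0//; lra.
  by rewrite ltNge; apply/negP.
Qed.

End equivalence.

(** * Equality of the spaces and equivalence of the norms *)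

Theorem theorem3p5 (R : realType) (d : nat) (hd : (1 <= d)%N)
    (n : R) (hn : 0 < n <= d%:R)
    (mu : {measure set (euclidean R d) -> \bar R}) (hmu : radon mu)
    (C0 : R) (hC0 : 0 < C0) (hgrowth : growth mu n C0)
    (alpha eta : {posnum R}) (beta : R)
    (halpha : 1 < alpha%:num)
    (heta : 1 < eta%:num <= alpha%:num)
    (hbeta : alpha%:num ^+ d < beta) :
  rbmo1 mu n alpha eta beta = rbmo2 mu n alpha eta beta /\
  exists C : R, 1 <= C /\
    forall f : euclidean R d -> R, rbmo1 mu n alpha eta beta f ->
      C^-1 * rbmo1_norm mu n alpha eta beta f
        <= rbmo2_norm mu n alpha eta beta f /\
      rbmo2_norm mu n alpha eta beta f
        <= C * rbmo1_norm mu n alpha eta beta f.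
Proof.
have /andP[/ltW n0 nd] := hn; have /andP[eta1 eta_alpha] := heta.
have [A A1 hA] := rbmo1_of_rbmo2 n0 nd hC0 hgrowth halpha eta1 eta_alpha hbeta.
have [B B1 hB] :=
  rbmo2_of_rbmo1 hd n0 nd hC0 hgrowth halpha eta1 eta_alpha hbeta.
split.
  apply/seteqP; split => f [hf].
    by move=> [C hC]; split => //; exists (B * C); eexists; exact: hB hf hC.
  by move=> [C [fQ hC]]; split => //; exists (A * C); exact: hA hf hC.
have A0 : 0 < A by exact: lt_le_trans A1.
have B0 : 0 < B by exact: lt_le_trans B1.
exists (Num.max A B); split; first by rewrite le_max A1.
move=> f [hf [C1 hC1]].
have lb1 : has_lbound [set C | rbmo1_bound mu n alpha eta beta f C].
  by exists 0 => C [].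
have lb2 : has_lbound
    [set C | exists fQ, rbmo2_bound mu n alpha eta beta f fQ C].
  by exists 0 => C [fQ []].
have inf1 : 0 <= rbmo1_norm mu n alpha eta beta f.
  by apply: lb_le_inf; [exists C1 | move=> C []].
have inf2 : 0 <= rbmo2_norm mu n alpha eta beta f.
  apply: lb_le_inf; last by move=> C [fQ []].
  by exists (B * C1); eexists; exact: hB hf hC1.
have M0 : 0 < Num.max A B by rewrite lt_max A0.
split.
  rewrite ler_pdivrMl//.
  apply: (@le_trans _ _ (A * rbmo2_norm mu n alpha eta beta f)); last first.
    by rewrite ler_wpM2r// le_max lexx.
  rewrite -ler_pdivrMl//; apply: lb_le_inf.
    by exists (B * C1); eexists; exact: hB hf hC1.
  move=> C [fQ hC]; rewrite ler_pdivrMl//.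
  by apply: ge_inf => //; exact: hA hf hC.
apply: (@le_trans _ _ (B * rbmo1_norm mu n alpha eta beta f)); last first.
  by rewrite ler_wpM2r// le_max lexx orbT.
rewrite -ler_pdivrMl//; apply: lb_le_inf; first by exists C1.
move=> C hC; rewrite ler_pdivrMl//.
by apply: ge_inf => //; eexists; exact: hB hf hC.
Qed.
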